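(* Let $\mathcal{M}$ be a von Neumann algebra and $\Phi_1,\Phi_2\in\mathrm{CP}(\mathcal{M},\mathcal{M})$. If there exist $\lambda_1,\lambda_2>0$ such that $\Phi_i\ge_{\mathrm{cp}}\lambda_i\,\mathrm{id}_{\mathcal{M}}$ for $i=1,2$, then \[ \Phi_1\#\Phi_2\ge_{\mathrm{cp}}\sqrt{\lambda_1\lambda_2}\;\mathrm{id}_{\mathcal{M}} . \] In particular, if $\mathrm{Ind}_{\mathrm{cp}}(\Phi_i)<\infty$ for $i=1,2$, then \[ \mathrm{Ind}_{\mathrm{cp}}(\Phi_1\#\Phi_2)\le\sqrt{\mathrm{Ind}_{\mathrm{cp}}(\Phi_1)\,\mathrm{Ind}_{\mathrm{cp}}(\Phi_2)} . \]
   Context: $\mathrm{CP}(\mathcal{M},\mathcal{N})$ is the set of all completely positive (CP) maps $\mathcal{M}\to\mathcal{N}$ (not assumed normal). $\Phi\le_{\mathrm{cp}}\Psi$ means $\Psi-\Phi$ is CP. For $\Phi\in\mathrm{CP}(\mathcal{M},\mathcal{M})$ the (Pimsner–Popa) index is $\mathrm{Ind}_{\mathrm{cp}}(\Phi):=\inf\{\lambda>0\mid\lambda\Phi-\mathrm{id}_{\mathcal{M}}\ge_{\mathrm{cp}}0\}$ (with $\inf\emptyset=\infty$). Forms: for a complex vector space $\mathcal{V}$ and positive sesquilinear forms $\alpha,\beta$ on $\mathcal{V}$ (linear in the first variable), a compatible representation consists of a linear map $h$ from $\mathcal{V}$ onto a dense subspace of a Hilbert space $\mathcal{H}$ and commuting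 positive $A,B\in\mathbb{B}(\mathcal{H})$ with $\alpha(x,y)=\langle Ah(x),h(y)\rangle$, $\beta(x,y)=\langle Bh(x),h(y)\rangle$. By Pusz–Woronowicz such representations always exist and the form $(\alpha\#\beta)(x,y):=\langle\sqrt{AB}\,h(x),h(y)\rangle$ does not depend on the choice. CP maps: $L^2(\mathcal{N})$ is the standard form Hilbert space of $\mathcal{N}$. For $\Phi\in\mathrm{CP}(\mathcal{M},\mathcal{N})$, $s_\Phi$ is the positive sesquilinear form on the algebraic tensor product $\mathcal{M}\odot L^2(\mathcal{N})$ given by $s_\Phi(x\otimes\xi,y\otimes\eta)=\langle\Phi(y^*x)\xi,\eta\rangle$. The geometric mean $\Phi\#\Psi\in\mathrm{CP}(\mathcal{M},\mathcal{N})$ is the unique CP map with $\langle(\Phi\#\Psi)(y^*x)\xi,\eta\rangle=(s_\Phi\#s_\Psi)(x\otimes\xi,y\otimes\eta)$ for all $x,y\in\mathcal{M}$, $\xi,\eta\in L^2(\mathcal{N})$. (Here it is applied with $\mathcal{N}=\mathcal{M}$.) *)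

(* Defs.v *)
From HB Require Import structures.
From mathcomp Require Import all_boot all_order all_algebra.
From mathcomp Require Import complex.
From mathcomp Require Import all_classical all_reals all_analysis.

Set Implicit Arguments.
Unset Strict Implicit.
Unset Printing Implicit Defensive.

Import Order.TTheory GRing.Theory Num.Theory.
Import numFieldNormedType.Exports.

Local Open Scope classical_set_scope.
Local Open Scope complex_scope.
Local Open Scope ring_scope.

Section AlgebraicTensorProduct.
Context {K : fieldType} (U V : lmodType K).

(* The algebraic tensor product of two vector spaces, realised as the span of
   the evaluations b |-> b u v in the algebraic dual of the space of bilinear
   forms on U x V; over a field, bilinear forms separate the points of the
   tensor product, so nothing is identified beyond the tensor relations. *)
Definition elementary (u : U) (v : V) : {bilinear U -> V -> K^o} -> K^o :=
  fun b => b u v.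

Definition tensor_pred : {pred {bilinear U -> V -> K^o} -> K^o} :=
  [pred t | `[< exists s : seq (U * V),
                  t = \sum_(p <- s) elementary p.1 p.2 >]].

Lemma tensor_submod_closed : submod_closed tensor_pred.
Proof.
split=> [|a _ _ /asboolP[s ->] /asboolP[s' ->]].
  by apply/asboolP; exists [::]; rewrite big_nil.
apply/asboolP; exists ([seq (a *: p.1, p.2) | p <- s] ++ s').
rewrite big_cat big_map scaler_sumr; congr (_ + _).
by apply: eq_bigr => p _; apply/funext => b /=; rewrite /elementary linearZl_LR.
Qed.

HB.instance Definition _ :=
  GRing.isSubmodClosed.Build K _ tensor_pred tensor_submod_closed.

Definition tensor : Type := {t | t \in tensor_pred}.
HB.instance Definition _ := SubChoice.on tensor.
HB.instance Definition _ := [SubChoice_isSubLmodule of tensor by <:].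

Lemma elementary_tensor (u : U) (v : V) : elementary u v \in tensor_pred.
Proof. by apply/asboolP; exists [:: (u, v)]; rewrite big_seq1. Qed.

Definition tens (u : U) (v : V) : tensor :=
  Sub (elementary u v) (elementary_tensor u v).

End AlgebraicTensorProduct.

Record hilbert (R : realType) := Hilbert {
  hilbert_space :> completeNormedModType R[i];
  dotp : {dot hilbert_space for Num.conj};
  normr_dotp : forall x : hilbert_space, `|x| ^+ 2 = dotp x x }.
Arguments dotp {R h}.

Section Operators.
Context {R : realType} {H : hilbert R}.
Implicit Types (S T : H -> H) (A : set (H -> H)).

Definition bounded_op T := linear T /\ continuous T.

(* By the Riesz representation theorem the set below is a singleton when T is
   bounded. *)
Definition adj T : H -> H :=
  xget 0 [set S | bounded_op S /\ forall x y, dotp (T x) y = dotp x (S y)].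

Definition positive_op T := bounded_op T /\ forall x, 0 <= dotp (T x) x.

(* A positive operator has exactly one positive square root. *)
Definition op_sqrt T : H -> H :=
  xget 0 [set S | positive_op S /\ S \o S = T].

Definition commutant A : set (H -> H) :=
  [set T | bounded_op T /\ forall S, A S -> T \o S = S \o T].

Definition von_neumann A :=
  (forall T, A T -> A (adj T)) /\ commutant (commutant A) = A.

Lemma bounded_op_comp S T : bounded_op S -> bounded_op T -> bounded_op (S \o T).
Proof.
move=> [lS cS] [lT cT]; split=> [a x y|x]; first by rewrite /= lT lS.
exact: continuous_comp (cT x) (cS _).
Qed.

Lemma bounded_op_id : bounded_op (idfun : H -> H).
Proof. by split=> // x; exact: cvg_id. Qed.

Lemma bounded_op_lin (a : R[i]) S T :
  bounded_op S -> bounded_op T -> bounded_op (a *: S + T).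
Proof.
move=> [lS cS] [lT cT]; split=> [b x y|x].
  rewrite !fctE lS lT !scalerDr !scalerA (mulrC a b).
  by rewrite -!addrA; congr (_ + _); rewrite addrCA.
apply: (@continuousD _ _ _ (a *: S) T); last exact: cT.
exact: (@continuousZl_tmp _ _ _ S a x (cS x)).
Qed.

Lemma commutant_comp A S T :
  commutant A S -> commutant A T -> commutant A (S \o T).
Proof.
move=> [bS cS] [bT cT]; split=> [|U AU]; first exact: bounded_op_comp.
by rewrite -compA cT// compA cS// compA.
Qed.

Lemma commutant_submod_closed A : (forall T, A T -> linear T) ->
  submod_closed (mem (commutant A)).
Proof.
move=> lA; have A0 U : A U -> U 0 = 0.
  by move=> /lA /(_ (-1) 0 0); rewrite scaler0 addr0 scaleN1r addNr.
split=> [|a S T].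
  rewrite inE; split=> [|U /A0 U0]; last by apply/funext => x /=; rewrite U0.
  by split=> [a x y|x]; [rewrite scaler0 addr0|exact: cvg_cst].
rewrite !inE => -[bS cS] [bT cT]; split=> [|U AU]; first exact: bounded_op_lin.
apply/funext => x; have lU := lA _ AU; rewrite /= !fctE lU.
by have /= -> := congr1 (@^~ x) (cS _ AU); have /= -> := congr1 (@^~ x) (cT _ AU).
Qed.

End Operators.

Record vnalgebra (R : realType) (H : hilbert R) := VNAlgebra {
  vn_set : set (H -> H);
  vn_setP : von_neumann vn_set }.

Section VNAlgebraElements.
Context {R : realType} {H : hilbert R} (M : vnalgebra H).

Lemma vn_bicommutant : commutant (commutant (vn_set M)) = vn_set M.
Proof. by case: (vn_setP M). Qed.

Definition vn_pred : {pred H -> H} := mem (vn_set M).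

Lemma vn_submod_closed : submod_closed vn_pred.
Proof.
rewrite /vn_pred -vn_bicommutant.
by apply: commutant_submod_closed => T [[]].
Qed.

HB.instance Definition _ :=
  GRing.isSubmodClosed.Build R[i] _ vn_pred vn_submod_closed.

Definition vn_elt : Type := {T | T \in vn_pred}.
HB.instance Definition _ := SubChoice.on vn_elt.
HB.instance Definition _ := [SubChoice_isSubLmodule of vn_elt by <:].

Definition vn_op (x : vn_elt) : H -> H := val x.

Lemma vn_eltP (x : vn_elt) : vn_set M (vn_op x).
Proof. exact: set_mem (valP x). Qed.

Lemma vn_one_subproof : idfun \in vn_pred.
Proof.
apply/mem_set; rewrite -vn_bicommutant; split=> //; exact: bounded_op_id.
Qed.

Lemma vn_mul_subproof (x y : vn_elt) : vn_op x \o vn_op y \in vn_pred.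
Proof.
apply/mem_set; rewrite -vn_bicommutant.
by apply: commutant_comp; rewrite vn_bicommutant; exact: vn_eltP.
Qed.

Lemma vn_star_subproof (x : vn_elt) : adj (vn_op x) \in vn_pred.
Proof. by apply/mem_set; case: (vn_setP M) => + _; apply; exact: vn_eltP. Qed.

Definition vn_one : vn_elt := exist _ idfun vn_one_subproof.
Definition vn_mul (x y : vn_elt) : vn_elt :=
  exist _ (vn_op x \o vn_op y) (vn_mul_subproof x y).
Definition vn_star (x : vn_elt) : vn_elt :=
  exist _ (adj (vn_op x)) (vn_star_subproof x).

End VNAlgebraElements.

Coercion vn_elt : vnalgebra >-> Sortclass.
Coercion vn_op : vn_elt >-> Funclass.

(* Haagerup's standard form (N, L^2(N), J, P).  The algebra N is given on some
   Hilbert space H, not necessarily standardly; sf_rep is the *-isomorphism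
   (automatically normal) of N onto the von Neumann algebra that is in standard
   form.  The standard form is unique up to unitary equivalence. *)
Record standard_form (R : realType) (H : hilbert R) (N : vnalgebra H) :=
  StandardForm {
  sf_space :> hilbert R;
  sf_rep : N -> sf_space -> sf_space;
  sf_J : sf_space -> sf_space;
  sf_cone : set sf_space;
  sf_rep_linear : linear sf_rep;
  sf_rep_inj : injective sf_rep;
  sf_rep1 : sf_rep (vn_one N) = idfun;
  sf_repM : forall x y, sf_rep (vn_mul x y) = sf_rep x \o sf_rep y;
  sf_rep_star : forall x, sf_rep (vn_star x) = adj (sf_rep x);
  sf_rep_von_neumann : von_neumann (range sf_rep);
  sf_J_antilinear : forall (a : R[i]) (xi eta : sf_space),
    sf_J (a *: xi + eta) = Num.conj a *: sf_J xi + sf_J eta;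
  sf_J_isometric : forall xi eta, dotp (sf_J xi) (sf_J eta) = dotp eta xi;
  sf_JK : involutive sf_J;
  sf_cone_self_dual :
    sf_cone = [set xi | forall eta, sf_cone eta -> 0 <= dotp xi eta];
  sf_J_commutant :
    [set sf_J \o T \o sf_J | T in range sf_rep] = commutant (range sf_rep);
  sf_J_center : forall z, (forall x, vn_mul x z = vn_mul z x) ->
    sf_J \o sf_rep z \o sf_J = sf_rep (vn_star z);
  sf_J_cone : forall xi, sf_cone xi -> sf_J xi = xi;
  sf_cone_stable : forall x xi,
    sf_cone xi -> sf_cone (sf_rep x (sf_J (sf_rep x (sf_J xi)))) }.

Arguments sf_rep {R H N} s.
Arguments sf_J {R H N} s.
Arguments sf_cone {R H N} s.

Section CompletelyPositive.
Context {R : realType} {H K : hilbert R} {M : vnalgebra H} {N : vnalgebra K}.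

(* X, seen as an operator on the n-fold direct sum of H, is positive. *)
Definition mx_positive (G : hilbert R) (A : vnalgebra G) n (X : 'M[A]_n) :=
  forall xi : 'I_n -> G, 0 <= \sum_i \sum_j dotp (X i j (xi j)) (xi i).

Definition CP (Phi : M -> N) :=
  linear Phi /\
  forall n (X : 'M[M]_n), mx_positive X -> mx_positive (map_mx Phi X).

Definition le_cp (Phi Psi : M -> N) := CP (Psi - Phi).

End CompletelyPositive.

Definition Ind_cp (R : realType) (H : hilbert R) (M : vnalgebra H)
    (Phi : M -> M) : \bar R :=
  ereal_inf [set lambda%:E | lambda in
    [set lambda : R | 0 < lambda /\ le_cp idfun (lambda%:C *: Phi)]].

Definition sesquilinear (R : realType) (V : lmodType R[i])
    (alpha : V -> V -> R[i]) :=
  (forall y, scalar (alpha^~ y)) /\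
  (forall x, linear_for (Num.conj \; *%R) (alpha x)).

Record compatible_rep (R : realType) (V : lmodType R[i])
    (alpha beta : V -> V -> R[i]) := CompatibleRep {
  cr_space : hilbert R;
  cr_map : V -> cr_space;
  cr_A : cr_space -> cr_space;
  cr_B : cr_space -> cr_space;
  cr_map_linear : linear cr_map;
  cr_map_dense : dense (range cr_map);
  cr_A_positive : positive_op cr_A;
  cr_B_positive : positive_op cr_B;
  cr_AB_comm : cr_A \o cr_B = cr_B \o cr_A;
  cr_A_form : forall x y, alpha x y = dotp (cr_A (cr_map x)) (cr_map y);
  cr_B_form : forall x y, beta x y = dotp (cr_B (cr_map x)) (cr_map y) }.
Arguments cr_map {R V alpha beta} c.
Arguments cr_A {R V alpha beta} c.
Arguments cr_B {R V alpha beta} c.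

(* gamma = alpha # beta; for positive sesquilinear alpha and beta, compatible
   representations exist and all of them yield the same gamma
   (Pusz-Woronowicz). *)
Definition form_gmean (R : realType) (V : lmodType R[i])
    (alpha beta gamma : V -> V -> R[i]) :=
  exists r : compatible_rep alpha beta, forall x y,
    gamma x y = dotp (op_sqrt (cr_A r \o cr_B r) (cr_map r x)) (cr_map r y).

Section GeometricMeanOfCPMaps.
Context {R : realType} {H K : hilbert R} {M : vnalgebra H} {N : vnalgebra K}.
Context (L2N : standard_form N).
Implicit Types Phi Psi Theta : M -> N.

(* s = s_Phi; the tensors x (x) xi span, so this determines s. *)
Definition cp_form Phi (s : tensor M L2N -> tensor M L2N -> R[i]) :=
  sesquilinear s /\
  forall (x y : M) (xi eta : L2N),
    s (tens x xi) (tens y eta) =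
    dotp (sf_rep L2N (Phi (vn_mul (vn_star y) x)) xi) eta.

(* Theta = Phi # Psi; for CP maps Phi and Psi there is exactly one such Theta. *)
Definition cp_gmean Phi Psi Theta :=
  CP Theta /\
  exists s_Phi s_Psi s,
    [/\ cp_form Phi s_Phi, cp_form Psi s_Psi, form_gmean s_Phi s_Psi s &
      forall (x y : M) (xi eta : L2N),
        dotp (sf_rep L2N (Theta (vn_mul (vn_star y) x)) xi) eta =
        s (tens x xi) (tens y eta)].

End GeometricMeanOfCPMaps.

(* Main.v *)
(* Since Phi - l id is CP exactly when s_Phi - l s_id is a positive form, and
   s_id (t, t') = <p t, p t'> with p (x (x) xi) = x xi, the statement reduces to
   forms: if alpha >= l1 q and beta >= l2 q with q positive, then
   alpha # beta >= sqrt (l1 l2) q.  In a compatible representation this says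
   that x (u, t) <= (<A u, u> + <B t, t>) / 2 forces x <= S for the square root
   S of AB.  If -m < 0 is the infimum of S - x on unit vectors, an approximate
   minimiser w is an approximate eigenvector, and testing the bound on the pair
   (w, (S + m) (B + e)^-1 w) contradicts (S + m)^2 > A (B + e) for small e.

   Positivity of a matrix over M does not depend on whether M acts on H or on
   L^2(M): a positive matrix T equals W^* W with W the square root of T, whose
   entries are again in M by the double commutant property. *)
Require Import Defs.
From HB Require Import structures.
From mathcomp Require Import all_boot all_order all_algebra.
From mathcomp Require Import complex.
From mathcomp Require Import all_classical all_reals all_analysis.
From mathcomp Require Import ring lra.
Import Order.TTheory GRing.Theory Num.Theory.
Import numFieldNormedType.Exports.
Set Implicit Arguments.
Unset Strict Implicit.
Unset Printing Implicit Defensive.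
Local Open Scope classical_set_scope.
Local Open Scope complex_scope.
Local Open Scope ring_scope.
Local Notation Re := complex.Re.
Local Notation Im := complex.Im.


(** The inequality for forms is the maximality of the Pusz-Woronowicz mean. For invertible [B],
    optimising over [t] turns the two-variable bound into [x B^-1 x <= A], and operator monotonicity
    of the square root concludes; the approximate eigenvector is the classical proof of that
    monotonicity, run with [B + e] in place of [B].

    The form [x] lives on the domain of [h], whose range is merely dense, while the test vector lies
    in the completion. So [x] must first be eliminated, by near-minimality of [w], and only then is
    the bound extended by continuity.

    The analysis takes place in real Hilbert spaces, a complex one being regarded as real through
    the real part of its inner product: inequalities then live in an ordered field, and complex
    linearity is recovered as commutation with multiplication by ['i]. Square roots come from a
    polynomial iteration with error of order [1/n], so they commute with everything that commutes
    with the given operator; most later arguments rest on this. *)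

(** * Errors of order 1/n, and linear maps given as plain functions *)

Lemma le0_harmonic (R : realType) (x C : R) :
  (forall n, x <= C / n.+1%:R) -> x <= 0.
Proof.
move=> xC; rewrite leNgt; apply/negP => x0.
have := archi_boundP (x := `|C| / x) (divr_ge0 (normr_ge0 _) (ltW x0)).
rewrite ltr_pdivrMr// => Cx.
have := xC (Num.bound (`|C| / x)); rewrite ler_pdivlMr// -natr1.
have := ler_norm C; nra.
Qed.

Section LinearFunctions.
Context {R : nzRingType} {U V : lmodType R} {T : U -> V} (lT : linear T).

Lemma linear_fctD x y : T (x + y) = T x + T y.
Proof. by have := lT 1 x y; rewrite !scale1r. Qed.

Lemma linear_fct0 : T 0 = 0.
Proof. by apply: (addrI (T 0)); rewrite -linear_fctD !addr0. Qed.

Lemma linear_fctZ a x : T (a *: x) = a *: T x.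
Proof. by have := lT a x 0; rewrite linear_fct0 !addr0. Qed.

Lemma linear_fctN x : T (- x) = - T x.
Proof. by rewrite -scaleN1r linear_fctZ scaleN1r. Qed.

Lemma linear_fctB x y : T (x - y) = T x - T y.
Proof. by rewrite linear_fctD linear_fctN. Qed.

End LinearFunctions.

(** * Semi-inner products and real Hilbert spaces *)

Section SemiInnerProducts.
Context {R : realType} {V : lmodType R}.
Implicit Types b : V -> V -> R.

(** Definiteness is left out so that the comparison form [x] of [le_geometric_mean] and the forms
    [b (T x) y] of positive [T] are instances. *)
Record semi_inner b : Prop := SemiInner {
  semi_innerP : forall a x y z, b (a *: x + y) z = a * b x z + b y z;
  semi_innerC : forall x y, b x y = b y x;
  semi_inner_ge0 : forall x, 0 <= b x x }.

Definition seminorm b x := Num.sqrt (b x x).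

Section Theory.
Context {b} (hb : semi_inner b).
Local Notation nrm := (seminorm b).

Lemma semi_innerDl x y z : b (x + y) z = b x z + b y z.
Proof. by have := semi_innerP hb 1 x y z; rewrite scale1r mul1r. Qed.

Lemma semi_inner0l z : b 0 z = 0.
Proof. by apply: (addrI (b 0 z)); rewrite -semi_innerDl !addr0. Qed.

Lemma semi_innerZl a x z : b (a *: x) z = a * b x z.
Proof. by have := semi_innerP hb a x 0 z; rewrite semi_inner0l !addr0. Qed.

Lemma semi_innerNl x z : b (- x) z = - b x z.
Proof. by rewrite -scaleN1r semi_innerZl mulN1r. Qed.

Lemma semi_innerDr x y z : b z (x + y) = b z x + b z y.
Proof. by rewrite !(semi_innerC hb z) semi_innerDl. Qed.

Lemma semi_innerZr a x z : b z (a *: x) = a * b z x.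
Proof. by rewrite !(semi_innerC hb z) semi_innerZl. Qed.

Lemma semi_innerNr x z : b z (- x) = - b z x.
Proof. by rewrite !(semi_innerC hb z) semi_innerNl. Qed.

Definition semi_innerE := (semi_innerDl, semi_innerDr, semi_innerZl,
  semi_innerZr, semi_innerNl, semi_innerNr).

Lemma cauchy_schwarz x y : b x y ^+ 2 <= b x x * b y y.
Proof.
have q t : 0 <= b x x - 2 * t * b x y + t ^+ 2 * b y y.
  have := semi_inner_ge0 hb (x - t *: y); rewrite !semi_innerE (semi_innerC hb
    y x).
  by congr (_ <= _); ring.
have [y0|y0] := eqVneq (b y y) 0.
  have [->|xy0] := eqVneq (b x y) 0; first by rewrite expr0n y0 mulr0.
  (* For [b y y = 0] the quadratic is affine in [t]; this [t] gives it the value -1. *)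
  have := q ((b x x + 1) / (2 * b x y)); rewrite y0 mulr0 addr0.
  have -> : 2 * ((b x x + 1) / (2 * b x y)) * b x y = b x x + 1 by field.
  lra.
have yp : 0 < b y y by rewrite lt_def y0 (semi_inner_ge0 hb).
have := q (b x y / b y y).
have -> : b x x - 2 * (b x y / b y y) * b x y + (b x y / b y y) ^+ 2 * b y y =
  (b x x * b y y - b x y ^+ 2) / b y y by field.
by rewrite ler_pdivlMr// mul0r subr_ge0.
Qed.

Lemma seminorm_ge0 x : 0 <= nrm x. Proof. exact: sqrtr_ge0. Qed.

Lemma sqr_seminorm x : nrm x ^+ 2 = b x x.
Proof. by rewrite sqr_sqrtr// semi_inner_ge0. Qed.

Lemma seminorm_le x c : 0 <= c -> (nrm x <= c) = (b x x <= c ^+ 2).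
Proof.
by move=> c0; rewrite -(sqr_seminorm x) ler_pXn2r// ?nnegrE ?seminorm_ge0.
Qed.

Lemma le_seminorm_mul x y : b x y <= nrm x * nrm y.
Proof.
rewrite -sqrtrM ?semi_inner_ge0//.
apply: le_trans (ler_norm _) _; rewrite -sqrtr_sqr.
by rewrite ler_sqrt ?cauchy_schwarz// mulr_ge0 ?semi_inner_ge0.
Qed.

Lemma seminormZ a x : nrm (a *: x) = `|a| * nrm x.
Proof. by rewrite /nrm !semi_innerE mulrA -expr2 sqrtrM ?sqr_ge0// sqrtr_sqr.
  Qed.

Lemma seminormN x : nrm (- x) = nrm x.
Proof. by rewrite -scaleN1r seminormZ normrN1 mul1r. Qed.

Lemma seminormB x y : nrm (x - y) = nrm (y - x).
Proof. by rewrite -opprB seminormN. Qed.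

Lemma seminormD x y : nrm (x + y) <= nrm x + nrm y.
Proof.
rewrite seminorm_le ?addr_ge0 ?seminorm_ge0// !semi_innerE (semi_innerC hb y x).
rewrite sqrrD !sqr_seminorm; have := le_seminorm_mul x y; lra.
Qed.

Lemma seminorm_dist z x y : nrm (x - y) <= nrm (x - z) + nrm (z - y).
Proof. by apply: le_trans (seminormD _ _); rewrite addrA subrK. Qed.

End Theory.

(* Completeness is stated for sequences that are Cauchy at the rate 1/n, which
   suffices for the minimising sequence of [riesz] and for [sqrt_iter]. *)
Record hilbert_form b : Prop := HilbertForm {
  hilbert_semi :> semi_inner b;
  hilbert_def : forall x, b x x = 0 -> x = 0;
  hilbert_complete : forall (u : nat -> V) (C : R),
    (forall m n, (m <= n)%N -> seminorm b (u n - u m) <= C / m.+1%:R) ->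
    exists l C', forall n, seminorm b (u n - l) <= C' / n.+1%:R }.

Definition bounded_for b (T : V -> V) :=
  exists2 C, 0 <= C & forall x, seminorm b (T x) <= C * seminorm b x.

(** Over the reals, symmetry does not follow from [0 <= b (T x) x], hence the separate field. *)
Record positive_for b (T : V -> V) : Prop := PositiveFor {
  positive_linear : linear T;
  positive_sym : forall x y, b (T x) y = b x (T y);
  positive_ge0 : forall x, 0 <= b (T x) x;
  positive_bounded : bounded_for b T }.

Lemma semi_inner_positive b T :
  semi_inner b -> positive_for b T -> semi_inner (fun x y => b (T x) y).
Proof.
move=> hb pT; split=> [a x y z|x y|x]; last exact: positive_ge0 pT x.
  by rewrite (positive_linear pT) (semi_innerP hb).
by rewrite (positive_sym pT) (semi_innerC hb).
Qed.

Section HilbertTheory.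
Context {b} (hb : hilbert_form b).
Local Notation nrm := (seminorm b).

Lemma hilbert_nrm0 x : nrm x <= 0 -> x = 0.
Proof.
move=> x0; apply: (hilbert_def hb); rewrite -(sqr_seminorm hb).
suff -> : nrm x = 0 by rewrite expr0n.
by apply/eqP; rewrite eq_le x0 seminorm_ge0.
Qed.

Lemma hilbert_small x C : (forall n, nrm x <= C / n.+1%:R) -> x = 0.
Proof. by move=> /le0_harmonic/hilbert_nrm0. Qed.

Lemma hilbert_ext x y : (forall z, b x z = b y z) -> x = y.
Proof.
move=> xy; apply/subr0_eq; apply: (hilbert_def hb).
by rewrite (semi_innerDl hb) (semi_innerNl hb) xy subrr.
Qed.

(* The representing vector minimises [b x x - 2 f x]. *)
Lemma riesz (f : V -> R) (C : R) : (forall a x y,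
  f (a *: x + y) = a * f x + f y) ->
  (forall x, f x <= C * nrm x) -> exists z, forall x, b z x = f x.
Proof.
move=> fP fC; pose J x := b x x - 2 * f x.
have f0 : f 0 = 0.
  by have := fP 1 0 0; rewrite scaler0 addr0 mul1r => /eqP;
    rewrite addrC -subr_eq subrr eq_sym => /eqP.
have fZ a x : f (a *: x) = a * f x by have := fP a x 0; rewrite f0 !addr0.
have fD x y : f (x + y) = f x + f y by have := fP 1 x y; rewrite scale1r mul1r.
have hinf : has_inf (range J).
  split; first by exists (J 0), 0.
  exists (- C ^+ 2) => _ [x _ <-]; rewrite /J -(sqr_seminorm hb).
  by have := fC x; have := sqr_ge0 (nrm x - C); nra.
have Jinf x : inf (range J) <= J x.
  by apply: ge_inf; [case: hinf|exists x].
(* By the parallelogram identity at the midpoint, near-minimality up to [e n] controls squared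
   distances, so the minimising sequence is Cauchy at rate [1 / n.+1]. *)
pose e n : R := n.+1%:R ^- 2.
have e0 n : 0 < e n by rewrite invr_gt0 exprn_gt0.
have /boolp.choice[u uJ] : forall n, exists x, J x < inf (range J) + e n.
  by move=> n; have [_ [x _ <-] ?] := inf_adherent (e0 n) hinf; exists x.
have [m n mn|z [K zK]] := hilbert_complete hb (u := u) (C := 2).
  rewrite (seminorm_le hb) ?divr_ge0//.
  have := Jinf (2^-1 *: (u n + u m)).
  have := uJ n; have := uJ m.
  have -> : (2 / m.+1%:R) ^+ 2 = 4 * e m by rewrite exprMn exprVn;
    congr (_ * _); ring.
  have : e n <= e m.
    by rewrite lef_pV2 ?posrE ?exprn_gt0// ler_pXn2r ?nnegrE// ler_nat.
  rewrite /J !(semi_innerE hb) fZ fD (semi_innerC hb (u m) (u n)); lra.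
exists z => x; apply/eqP; rewrite -subr_eq0 -normr_le0.
apply: (@le0_harmonic _ _ ((b x x + 1) / 2 + K * nrm x)) => n.
have i0 : 0 < n.+1%:R^-1 :> R by rewrite invr_gt0.
(* Near-minimality of [u n] along the direction [x]. With [s] equal to plus or minus [1 / n.+1] both
   error terms are quadratic in [1 / n.+1], and dividing by [s] leaves order [1 / n.+1]. *)
have A1 s : 0 <= 2 * s * (b (u n) x - f x) + s ^+ 2 * b x x + e n.
  have := Jinf (s *: x + u n); have := uJ n.
  rewrite /J fP !(semi_innerE hb) (semi_innerC hb x); lra.
have := A1 n.+1%:R^-1; have := A1 (- n.+1%:R^-1); rewrite /e -exprVn.
have := le_seminorm_mul hb (u n - z) x.
have := le_seminorm_mul hb (z - u n) x.
rewrite (seminormB hb z) !(semi_innerE hb) ler_norml.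
have : nrm (u n - z) * nrm x <= K * n.+1%:R^-1 * nrm x.
  by rewrite ler_wpM2r ?seminorm_ge0.
move: (b _ _) (f x) (b z x) (nrm x) (nrm _ * _) i0 (b x x) => p q r s t.
move: n.+1%:R^-1 => i i0 bx h1 h2 h3 h4 h5.
have {}h4 : (2 * (p - q)) - i * bx <= i by rewrite -(ler_pM2l i0); lra.
have {}h5 : (2 * (p - q)) + i * bx + i >= 0 by rewrite -(ler_pM2l i0); lra.
by apply/andP; split; lra.
Qed.

End HilbertTheory.
End SemiInnerProducts.

(** * Square roots of positive operators *)

Section SquareRoot.
Context {R : realType} {V : lmodType R} {b : V -> V -> R} (hb : hilbert_form b).
Local Notation nrm := (seminorm b).

(* [sqrt_iter D] converges to [1 - sqrt (1 - D)]; the scalar iteration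
   [sqrt_rate], i.e. the case [D = 1], controls the rate. *)
Fixpoint sqrt_iter (D : V -> V) k x : V :=
  if k is k'.+1 then 2^-1 *: (D x + sqrt_iter D k' (sqrt_iter D k' x)) else 0.

Fixpoint sqrt_rate k : R :=
  if k is k'.+1 then (1 + sqrt_rate k' ^+ 2) / 2 else 0.

Lemma sqrt_rate_ge0 k : 0 <= sqrt_rate k.
Proof. by case: k => //= k; rewrite divr_ge0// addr_ge0// sqr_ge0. Qed.

(** The gap [g = 1 - sqrt_rate k] evolves by [g - g^2 / 2], whose decay is of order [2 / k]. *)
Lemma sqrt_rate_bound k : 1 - 2 / k.+1%:R <= sqrt_rate k <= 1.
Proof.
(* The shifted lower bound is nonnegative already at [k = 0], so the induction may square it. *)
suff : 1 - 2 / k.+2%:R <= sqrt_rate k <= 1.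
  move=> /andP[h ->]; rewrite andbT; apply: le_trans h.
  by rewrite lerD2l lerN2 ler_pM2l// lef_pV2 ?posrE// ler_nat.
elim: k => [|k /andP[h1 h2]] /=; first by apply/andP; split; lra.
have n0 : 0 < k.+2%:R :> R by [].
rewrite -[k.+3]addn1 natrD; set n : R := k.+2%:R in h1 n0 *.
have n2 : 2 <= n by rewrite /n ler_nat.
move: (n) (n0) n2 h1 => {n0} {}n n0 n2 h1.
have i0 : 0 < n^-1 by rewrite invr_gt0.
have i1 : n^-1 * n = 1 by rewrite mulVf// gt_eqF.
have i2 : n^-1 <= 2^-1 by rewrite lef_pV2 ?posrE.
have j0 : 0 < (n + 1)^-1 by rewrite invr_gt0; lra.
have j1 : (n + 1)^-1 * (n + 1) = 1 by rewrite mulVf// gt_eqF//; lra.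
have r0 := sqrt_rate_ge0 k.
apply/andP; split; last by nra.
have h : (1 - 2 * n^-1) ^+ 2 <= sqrt_rate k ^+ 2 by rewrite ler_pXn2r ?nnegrE
  //; lra.
suff : n^-1 - n^-1 ^+ 2 <= (n + 1)^-1 by lra.
rewrite -(ler_pM2r (_ : 0 < n + 1)); last lra.
have -> : (n^-1 - n^-1 ^+ 2) * (n + 1) = n^-1 * n + n^-1 - n^-1 * (n^-1 * n) -
  n^-1 ^+ 2.
  by ring.
by rewrite j1 i1; have := sqr_ge0 n^-1; lra.
Qed.

Lemma sqrt_rate_le m n : sqrt_rate n - sqrt_rate m <= 2 / m.+1%:R.
Proof.
have /andP[h _] := sqrt_rate_bound m; have /andP[_ h'] := sqrt_rate_bound n.
by apply: le_trans (lerB h' h) _; rewrite opprB addrC subrK.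
Qed.

Section Contraction.
Variable D : V -> V.
Hypotheses (lD : linear D) (D1 : forall x, nrm (D x) <= nrm x).
Local Notation Y := (sqrt_iter D).
Local Notation p := sqrt_rate.

Lemma sqrt_iter_linear k : linear (Y k).
Proof.
elim: k => [|k IH] a x y /=; first by rewrite scaler0 addr0.
rewrite lD !IH !scalerDr !scalerA (mulrC a) -!addrA; congr (_ + _).
by rewrite addrCA.
Qed.

Lemma sqrt_iter_comm (E : V -> V) k :
  linear E -> (forall x, E (D x) = D (E x)) -> forall x, E (Y k x) = Y k (E x).
Proof.
move=> lE cE; elim: k => [|k IH] x /=; first exact: linear_fct0.
by rewrite (linear_fctZ lE) (linear_fctD lE) cE !IH.
Qed.

Lemma sqrt_iter_comm2 j k x : Y j (Y k x) = Y k (Y j x).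
Proof.
apply: sqrt_iter_comm => {}x; first exact: sqrt_iter_linear.
by apply/esym/sqrt_iter_comm.
Qed.

Lemma sqrt_iter_bound k x : nrm (Y k x) <= p k * nrm x.
Proof.
elim: k x => [|k IH] x /=; first by rewrite mul0r /seminorm (semi_inner0l hb)
  sqrtr0.
rewrite (seminormZ hb) ger0_norm ?invr_ge0//.
have h1 := seminormD hb (D x) (Y k (Y k x)).
have h2 := IH (Y k x); have h3 := IH x; have h4 := D1 x.
have h5 := sqrt_rate_ge0 k.
have : p k * nrm (Y k x) <= p k * (p k * nrm x) by rewrite ler_wpM2l.
by lra.
Qed.

(** The iterates commute, so consecutive differences satisfy [Y'' - Y' = (Y' + Y)(Y' - Y) / 2]; the
    scalar rates obey the same identity, and the norms are compared term by term. *)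
Lemma sqrt_iter_step k x : nrm (Y k.+1 x - Y k x) <= (p k.+1 - p k) * nrm x.
Proof.
elim: k x => [|k IH] x.
  rewrite /= subr0 addr0 (seminormZ hb) ger0_norm ?invr_ge0// expr0n/=.
  by have := D1 x; lra.
have -> : Y k.+2 x - Y k.+1 x =
    2^-1 *: (Y k.+1 (Y k.+1 x - Y k x) + Y k (Y k.+1 x - Y k x)).
  have L1 := sqrt_iter_linear k.+1; have L := sqrt_iter_linear k.
  rewrite (linear_fctB L1) (linear_fctB L) (sqrt_iter_comm2 k k.+1) subrKA.
  by rewrite [Y k.+2 x]/= [Y k.+1 x in X in _ - X]/= -scalerBr opprD addrACA
    subrr add0r.
rewrite (seminormZ hb) ger0_norm ?invr_ge0//.
have h1 := seminormD hb (Y k.+1 (Y k.+1 x - Y k x)) (Y k (Y k.+1 x - Y k x)).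
have h2 := sqrt_iter_bound k (Y k.+1 x - Y k x).
have h3 := sqrt_iter_bound k.+1 (Y k.+1 x - Y k x).
have -> : (p k.+2 - p k.+1) = 2^-1 * (p k.+1 + p k) * (p k.+1 - p k).
  have e1 : p k.+1 = (1 + p k ^+ 2) / 2 by [].
  have : p k.+2 = (1 + p k.+1 ^+ 2) / 2 by [].
  by move: (p k.+2) (p k.+1) (p k) e1 => q r s; lra.
have : (p k.+1 + p k) * nrm (Y k.+1 x - Y k x) <=
       (p k.+1 + p k) * ((p k.+1 - p k) * nrm x).
  by rewrite ler_wpM2l ?addr_ge0 ?sqrt_rate_ge0.
move: (p k.+1) (p k) h1 h2 h3 => q r; lra.
Qed.

Lemma sqrt_iter_cauchy m n x : (m <= n)%N ->
  nrm (Y n x - Y m x) <= (p n - p m) * nrm x.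
Proof.
elim: n => [|n IH]; first by rewrite leqn0 => /eqP ->;
  rewrite !subrr mul0r /seminorm (semi_inner0l hb) sqrtr0.
rewrite leq_eqVlt => /predU1P[->|/IH h].
  by rewrite !subrr mul0r /seminorm (semi_inner0l hb) sqrtr0.
have := seminorm_dist hb (Y n x) (Y n.+1 x) (Y m x).
have := sqrt_iter_step n x; lra.
Qed.

Lemma sqrt_iter_sym : (forall x y, b (D x) y = b x (D y)) ->
  forall k x y, b (Y k x) y = b x (Y k y).
Proof.
move=> sD; elim=> [|k IH] x y /=.
  by rewrite (semi_inner0l hb) (semi_innerC hb) (semi_inner0l hb).
by rewrite !(semi_innerE hb) sD !IH.
Qed.

Lemma sqrt_iter_lim : exists Y' : V -> V, forall x, exists C, forall n,
  nrm (Y n x - Y' x) <= C / n.+1%:R.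
Proof.
suff /boolp.choice[Y' Y'P] : forall x, exists y, exists C, forall n,
    nrm (Y n x - y) <= C / n.+1%:R by exists Y'.
move=> x; apply: (hilbert_complete hb (C := 2 * nrm x)) => m n mn.
apply: le_trans (sqrt_iter_cauchy x mn) _.
by rewrite mulrAC ler_wpM2r ?seminorm_ge0// sqrt_rate_le.
Qed.

End Contraction.

Definition limit_of (u : nat -> V) (l : V) :=
  exists C, forall n, nrm (u n - l) <= C / n.+1%:R.

Lemma limit_of_unique u l l' : limit_of u l -> limit_of u l' -> l = l'.
Proof.
move=> [C hC] [C' hC']; apply/subr0_eq; apply: (hilbert_small hb (C := C + C'))
  => n.
apply: le_trans (seminorm_dist hb (u n) _ _) _.
by rewrite mulrDl lerD// (seminormB hb).
Qed.

Lemma limit_of_lin u v l l' a : limit_of u l -> limit_of v l' ->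
  limit_of (fun n => a *: u n + v n) (a *: l + l').
Proof.
move=> [C hC] [C' hC']; exists (`|a| * C + C') => n.
rewrite opprD addrACA -scalerBr; apply: le_trans (seminormD hb _ _) _.
by rewrite (seminormZ hb) mulrDl -mulrA lerD// ler_wpM2l.
Qed.

Lemma limit_of_bounded T u l : linear T -> bounded_for b T ->
  limit_of u l -> limit_of (fun n => T (u n)) (T l).
Proof.
move=> lT [K K0 hK] [C hC]; exists (K * C) => n.
rewrite -(linear_fctB lT); apply: le_trans (hK _) _.
by rewrite -mulrA ler_wpM2l.
Qed.

Lemma limit_of_shift u l : limit_of u l -> limit_of (fun n => u n.+1) l.
Proof.
move=> [C hC]; exists `|C| => n; apply: le_trans (hC _) _.
apply: le_trans (ler_wpM2r _ (ler_norm _)) _; first by rewrite invr_ge0.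
by rewrite ler_wpM2l// lef_pV2 ?posrE// ler_nat.
Qed.

Lemma limit_of_inner u l y : limit_of u l ->
  exists C, forall n, `|b (u n) y - b l y| <= C / n.+1%:R.
Proof.
move=> [C hC]; exists (C * nrm y) => n.
have -> : b (u n) y - b l y = b (u n - l) y by rewrite !(semi_innerE hb).
apply: le_trans (_ : nrm (u n - l) * nrm y <= _).
  rewrite ler_norml lerNl -(semi_innerNl hb) (le_seminorm_mul hb) andbT.
  by rewrite -(seminormN hb) (le_seminorm_mul hb).
by rewrite mulrAC ler_wpM2r ?seminorm_ge0.
Qed.

(** Here [Y] is [1 - sqrt (1 - D)]: the equation [2 Y = D + Y^2] says [(1 - Y)^2 = 1 - D]. The
    commutation clause passes to the limit from the iterates, which are polynomials in [D]. *)
Lemma sqrt_contraction (D : V -> V) : linear D ->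
    (forall x y, b (D x) y = b x (D y)) -> (forall x, nrm (D x) <= nrm x) ->
  exists Y, [/\ linear Y, forall x y, b (Y x) y = b x (Y y),
    forall x, nrm (Y x) <= nrm x, forall x, 2 *: Y x = D x + Y (Y x) &
    forall E : V -> V, linear E -> bounded_for b E ->
      (forall x, E (D x) = D (E x)) -> forall x, E (Y x) = Y (E x)].
Proof.
move=> lD sD D1; have [Y YP] := sqrt_iter_lim lD D1.
have {YP}YP x : limit_of (fun n => sqrt_iter D n x) (Y x) by apply: YP.
have lY : linear Y.
  move=> a x y; apply: limit_of_unique (YP _) _.
  under eq_fun do rewrite sqrt_iter_linear//.
  exact: limit_of_lin.
have Y1 x : nrm (Y x) <= nrm x.
  rewrite -subr_le0; have [C hC] := YP x; apply: (@le0_harmonic _ _ C) => n.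
  have := seminormD hb (Y x - sqrt_iter D n x) (sqrt_iter D n x).
  rewrite subrK (seminormB hb (Y x)); have := hC n; move: (C / _) => c.
  have := sqrt_iter_bound D1 n x; have /andP[_] := sqrt_rate_bound n.
  by move: (seminorm_ge0 (b := b) x); nra.
exists Y; split => //.
- move=> x y.
  have [C hC] := limit_of_inner y (YP x); have [C' hC'] := limit_of_inner x (YP
    y).
  apply/eqP; rewrite -subr_eq0 -normr_le0; apply: (@le0_harmonic _ _ (C + C'))
    => n.
  have h1 := hC n; have h2 := hC' n.
  rewrite (sqrt_iter_sym sD) distrC in h1; rewrite !(semi_innerC hb _ x) in h2.
  rewrite -(subrKA (b x (sqrt_iter D n y))) mulrDl.
  by apply: le_trans (ler_normD _ _) _; exact: lerD.
- move=> x; apply: limit_of_unique (_ : limit_of (fun n => 2 *: sqrt_iter D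
    n.+1 x) _) _.
    have := limit_of_lin 2 (limit_of_shift (YP x)) (_ : limit_of (fun=> 0) 0).
    have -> : (fun n => 2 *: sqrt_iter D n.+1 x + 0) = (fun n =>
      2 *: sqrt_iter D n.+1 x).
      by apply/funext => n; rewrite addr0.
    rewrite addr0; apply.
    by exists 0 => n; rewrite subrr mul0r /seminorm (semi_inner0l hb) sqrtr0.
  have [C hC] := YP x; have [C' hC'] := YP (Y x).
  exists (C + C') => n /=; rewrite scalerA divff// scale1r opprD addrACA subrr
    add0r.
  (* The product of two convergent sequences of operators: one factor is replaced at a time, the
     other being contractive. *)
  apply: le_trans (seminorm_dist hb (sqrt_iter D n (Y x)) _ _) _.
  rewrite mulrDl lerD// -(linear_fctB (sqrt_iter_linear lD n)).
  apply: le_trans (hC n); apply: le_trans (sqrt_iter_bound D1 _ _) _.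
  by rewrite ler_piMl ?seminorm_ge0//; have /andP[] := sqrt_rate_bound n.
- move=> E lE bE cE x; apply: limit_of_unique (YP (E x)).
  under eq_fun do rewrite -(sqrt_iter_comm _ lE cE).
  exact: limit_of_bounded.
Qed.

(** That is, [T^2 <= K T]: Cauchy-Schwarz for the form [b (T x) y], applied to [x] and [T x]. *)
Lemma positive_norm_le T K x : positive_for b T -> 0 <= K ->
  (forall x, nrm (T x) <= K * nrm x) -> b (T x) (T x) <= K * b (T x) x.
Proof.
move=> pT K0 hK; have hT := semi_inner_positive hb pT.
have cs := cauchy_schwarz hT x (T x).
have w1 := le_seminorm_mul hb (T (T x)) (T x); have w2 := hK (T x).
have nq := sqr_seminorm hb (T x); have n0 := seminorm_ge0 (b := b) (T x).
have t0 := positive_ge0 pT x; have q0 := semi_inner_ge0 hb (T x).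
have w : b (T (T x)) (T x) <= K * b (T x) (T x).
  by apply: le_trans w1 _; rewrite -nq expr2 mulrA ler_wpM2r.
have [->|qn0] := eqVneq (b (T x) (T x)) 0; first by rewrite mulr_ge0.
have qp : 0 < b (T x) (T x) by rewrite lt_def qn0.
rewrite -(ler_pM2r qp) -expr2; apply: le_trans cs _.
by rewrite mulrAC mulrC ler_wpM2r.
Qed.

(** Rescaling gives [T = c (1 - D)], where [D] is a contraction because [T^2 <= c T]; then
    [S = sqrt c (1 - Y)]. The last clause later yields uniqueness, complex linearity and membership
    in a von Neumann algebra. *)
Lemma positive_sqrt T : positive_for b T ->
  exists S, [/\ positive_for b S, forall x, S (S x) = T x &
    forall E : V -> V, linear E -> bounded_for b E ->
      (forall x, E (T x) = T (E x)) -> forall x, E (S x) = S (E x)].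
Proof.
move=> pT; have [K K0 hK] := positive_bounded pT; have lT := positive_linear pT.
(* [K] may be 0, and [c] has to be inverted. *)
pose c := K + 1; have c0 : 0 < c by rewrite /c; lra.
have hTT x : b (T x) (T x) <= c * b (T x) x.
  by have := positive_norm_le x pT K0 hK; have := positive_ge0 pT x;
    rewrite /c; lra.
pose D x := x - c^-1 *: T x.
have lD : linear D.
  move=> a x y; rewrite /D lT !scalerDr scalerN !scalerA (mulrC a) opprD.
  by rewrite -!addrA; congr (_ + _); rewrite addrCA.
have sD x y : b (D x) y = b x (D y).
  by rewrite /D !(semi_innerE hb) (positive_sym pT).
have D1 x : nrm (D x) <= nrm x.
  rewrite (seminorm_le hb) ?seminorm_ge0// (sqr_seminorm hb) /D !(semi_innerE
    hb).
  rewrite (semi_innerC hb x (T x)) -subr_ge0.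
  have i0 : 0 < c^-1 ^+ 2 by rewrite exprn_gt0// invr_gt0.
  have h : c^-1 ^+ 2 * b (T x) (T x) <= c^-1 * b (T x) x.
    have -> : c^-1 * b (T x) x = c^-1 ^+ 2 * (c * b (T x) x).
      by field; rewrite gt_eqF.
    by rewrite ler_pM2l.
  have : 0 <= c^-1 * b (T x) x by rewrite mulr_ge0 ?invr_ge0 ?(ltW c0)
    ?(positive_ge0 pT).
  lra.
have [Y [lY sY Y1 Y2 Yc]] := sqrt_contraction lD sD D1.
pose r := Num.sqrt c; have r0 : 0 <= r by exact: sqrtr_ge0.
have r2 : r * r = c by rewrite -expr2 sqr_sqrtr// ltW.
exists (fun x => r *: (x - Y x)); split.
- split.
  + move=> a x y; rewrite lY opprD addrACA scalerDr -scalerBr !scalerA mulrC.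
    by [].
  + by move=> x y; rewrite !(semi_innerE hb) sY.
  + move=> x; rewrite !(semi_innerE hb) mulr_ge0// subr_ge0.
    have := le_seminorm_mul hb (Y x) x; rewrite -(sqr_seminorm hb x).
    have := Y1 x; have := seminorm_ge0 (b := b) x; nra.
  + exists (r * 2) => [|x]; first by rewrite mulr_ge0.
    rewrite (seminormZ hb) ger0_norm// -mulrA ler_wpM2l//.
    have := seminormD hb x (- Y x); rewrite (seminormN hb); have := Y1 x; lra.
- move=> x; rewrite (linear_fctZ lY) (linear_fctB lY) -scalerBr scalerA r2.
  have -> : x - Y x - (Y x - Y (Y x)) = x - (2 *: Y x - Y (Y x)).
    by rewrite scaler_nat mulr2n !opprB opprD -!addrA; congr (_ + _);
      rewrite addrCA.
  by rewrite Y2 addrK /D opprB addrC subrK scalerA divff ?gt_eqF// scale1r.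
- move=> E lE bE cE x; rewrite (linear_fctZ lE) (linear_fctB lE) (Yc E)// =>
    {}x.
  by rewrite /D (linear_fctB lE) (linear_fctZ lE) cE.
Qed.

(** With [r] the square root of [S], which commutes with [T], the product is [r T r]. *)
Lemma positive_comp S T : positive_for b S -> positive_for b T ->
  (forall x, S (T x) = T (S x)) -> positive_for b (S \o T).
Proof.
move=> pS pT ST; have [r [pr rr rc]] := positive_sqrt pS.
have lS := positive_linear pS; have lT := positive_linear pT.
split.
- by move=> a x y; rewrite /= lT lS.
- by move=> x y; rewrite /= (positive_sym pS) (positive_sym pT) ST.
- move=> x; rewrite /= -rr -(rc T lT (positive_bounded pT)) => [|y];
    last by rewrite ST.
  by rewrite (positive_sym pr); exact: positive_ge0 pT _.
- have [C C0 hC] := positive_bounded pS; have [C' C'0 hC'] := positive_bounded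
    pT.
  exists (C * C'); first exact: mulr_ge0.
  by move=> x; apply: le_trans (hC _) _; rewrite -mulrA ler_wpM2l.
Qed.

Lemma positive_eq0 T x : positive_for b T -> b (T x) x = 0 -> T x = 0.
Proof.
move=> pT Tx; apply: (hilbert_def hb).
have [K K0 hK] := positive_bounded pT.
apply/eqP; rewrite eq_le (semi_inner_ge0 hb) andbT.
by apply: le_trans (positive_norm_le x pT K0 hK) _; rewrite Tx mulr0.
Qed.

(** [S] is an arbitrary positive square root, as [op_sqrt] is a mere choice; it is identified with
    the constructed root [r]. Both commute, so [(S + r) y = 0] for [y = S x - r x]; by positivity
    [S y = r y = 0], whence [b y y = 0]. *)
Lemma positive_sqrt_comm S T E : positive_for b S -> (forall x,
  S (S x) = T x) ->
  positive_for b T -> linear E -> bounded_for b E ->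
  (forall x, E (T x) = T (E x)) -> forall x, E (S x) = S (E x).
Proof.
move=> pS SS pT lE bE cE; have [r [pr rr rc]] := positive_sqrt pT.
have lr := positive_linear pr; have lS := positive_linear pS.
suff -> : S = r by exact: rc.
have rS x : r (S x) = S (r x).
  rewrite (rc S lS (positive_bounded pS))// => y.
  by rewrite -!SS.
apply/funext => x; set y := S x - r x.
have Sry : S y + r y = 0.
  rewrite /y (linear_fctB lS) (linear_fctB lr) SS rr rS.
  by rewrite subrKA subrr.
have /eqP : b (S y) y + b (r y) y = 0 by rewrite -(semi_innerDl hb) Sry
  (semi_inner0l hb).
rewrite paddr_eq0 ?(positive_ge0 pS) ?(positive_ge0 pr)// =>
  /andP[/eqP S0 /eqP r0].
apply/subr0_eq/(hilbert_def hb); rewrite -/y.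
have : y = S x - r x by []; move: (y) S0 r0 => {Sry}y' S0 r0 y'E.
rewrite {1}y'E (semi_innerDl hb) (semi_innerNl hb).
rewrite (positive_sym pS) (positive_sym pr).
by rewrite (positive_eq0 pS S0) (positive_eq0 pr r0) subrr.
Qed.

End SquareRoot.

(** * The geometric mean of commuting positive operators *)

Section Resolvent.
Context {R : realType} {V : lmodType R} {b : V -> V -> R} (hb : hilbert_form b).
Local Notation nrm := (seminorm b).

Lemma positive_le T : positive_for b T ->
  exists2 K, 0 < K & forall x, b (T x) x <= K * b x x.
Proof.
move=> pT; have [K K0 hK] := positive_bounded pT; exists (K + 1); first by lra.
move=> x; apply: le_trans (le_seminorm_mul hb _ _) _;
  rewrite -(sqr_seminorm hb).
by have := hK x; have := seminorm_ge0 (b := b) x; nra.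
Qed.

Lemma bounded_sqr T : bounded_for b T ->
  exists2 K, 0 < K & forall x, b (T x) (T x) <= K * b x x.
Proof.
move=> [K K0 hK]; exists (K ^+ 2 + 1); first by have := sqr_ge0 K; lra.
move=> x; apply: le_trans (_ : (K * nrm x) ^+ 2 <= _).
  by rewrite -(sqr_seminorm hb) ler_pXn2r ?nnegrE ?seminorm_ge0// mulr_ge0
    ?seminorm_ge0.
by rewrite exprMn (sqr_seminorm hb) ler_wpM2r ?(semi_inner_ge0 hb)//; lra.
Qed.

Definition shift_op (a : R) (T : V -> V) x := a *: x + T x.

Lemma positive_shift (a : R) T : 0 <= a -> positive_for b T ->
  positive_for b (shift_op a T).
Proof.
move=> a0 pT; have [K K0 hK] := positive_bounded pT; split.
- move=> c x y; rewrite /shift_op (positive_linear pT) !scalerDr !scalerA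
    (mulrC a).
  by rewrite -!addrA; congr (_ + _); rewrite addrCA.
- by move=> x y; rewrite /shift_op !(semi_innerE hb) (positive_sym pT).
- move=> x; rewrite /shift_op !(semi_innerE hb) addr_ge0 ?(positive_ge0 pT)//.
  by rewrite mulr_ge0 ?(semi_inner_ge0 hb).
- exists (a + K); first exact: addr_ge0.
  move=> x; apply: le_trans (seminormD hb _ _) _.
  by rewrite (seminormZ hb) ger0_norm// mulrDl lerD2l.
Qed.

(** The new form lies between [e b] and [K b], so both norms are equivalent and completeness is
    inherited. *)
Lemma hilbert_form_coercive (e : R) T : 0 < e -> positive_for b T ->
  (forall x, e * b x x <= b (T x) x) -> hilbert_form (fun x y => b (T x) y).
Proof.
move=> e0 pT he; have [K K0 hK] := positive_le pT.
pose b' := fun x y => b (T x) y.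
have hb' : semi_inner b' := semi_inner_positive hb pT.
pose k := Num.sqrt K; pose f := Num.sqrt e.
have f0 : 0 < f by rewrite sqrtr_gt0.
have lek x : seminorm b' x <= k * nrm x.
  by rewrite /seminorm -sqrtrM ?(ltW K0)// ler_sqrt ?hK// mulr_ge0 ?(ltW K0)
    ?(semi_inner_ge0 hb).
have lef x : f * nrm x <= seminorm b' x.
  by rewrite /seminorm -sqrtrM ?(ltW e0)// ler_sqrt ?he// (positive_ge0 pT).
split => //.
- move=> x Tx; apply: (hilbert_def hb); apply/eqP;
    rewrite eq_le (semi_inner_ge0 hb) andbT.
  by rewrite -(ler_pM2l e0) mulr0; apply: le_trans (he x) _; rewrite Tx.
- move=> u C hu; have [|l [C' hl]] := hilbert_complete hb (u := u) (C := C / f).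
    move=> m n /hu h; rewrite -(ler_pM2l f0).
    apply: le_trans (lef _) (le_trans h _).
    by rewrite mulrA mulrCA mulfV ?mulr1// gt_eqF.
  exists l, (k * C') => n; apply: le_trans (lek _) _.
  by rewrite -mulrA ler_wpM2l ?sqrtr_ge0.
Qed.

(** Riesz representation of the functional [b w] with respect to the form of [T]. *)
Lemma coercive_surjective (e : R) T w : 0 < e -> positive_for b T ->
  (forall x, e * b x x <= b (T x) x) -> exists z, T z = w.
Proof.
move=> e0 pT he; have hb' := hilbert_form_coercive e0 pT he.
pose f := Num.sqrt e.
have f0 : 0 < f by rewrite sqrtr_gt0.
have [||z hz] := riesz hb' (f := b w) (C := nrm w / f).
- by move=> a x y; rewrite !(semi_innerE hb).
- move=> x; apply: le_trans (le_seminorm_mul hb _ _) _.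
  rewrite -mulrA ler_wpM2l ?seminorm_ge0// ler_pdivlMl//.
  by rewrite /seminorm -sqrtrM ?(ltW e0)// ler_sqrt ?he// (positive_ge0 pT).
- by exists z; apply: (hilbert_ext hb).
Qed.

(** Both sides are continuous in the vector. This carries a bound known only on the range of [h] to
    the test vector of [le_geometric_mean]. *)
Lemma dense_quadratic {U : Type} (h : U -> V) Q y c :
  (forall v e, 0 < e -> exists t, nrm (h t - v) <= e) -> positive_for b Q ->
  (forall t, 2 * b y (h t) <= b (Q (h t)) (h t) + c) ->
  forall v, 2 * b y v <= b (Q v) v + c.
Proof.
move=> hd pQ ht v; rewrite -subr_le0.
have [K K0 hK] := positive_le pQ.
apply: (@le0_harmonic _ _ (2 * nrm (Q v) + K + 2 * nrm y)) => n.
have i0 : 0 < n.+1%:R^-1 :> R by rewrite invr_gt0.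
have i1 : n.+1%:R^-1 <= 1 :> R by rewrite invf_le1// ler1n.
move: (_^-1) i0 i1 => e e0 e1.
have [t te] := hd v e e0; have := ht t.
have [r rE] : exists r, r = h t - v by exists (h t - v).
have -> : h t = v + r by rewrite rE addrC subrK.
rewrite -rE in te; have lQ := positive_linear pQ.
rewrite (linear_fctD lQ) !(semi_innerE hb) (positive_sym pQ r v) (semi_innerC
  hb r).
have rr : b r r <= e.
  by rewrite -(sqr_seminorm hb); have := seminorm_ge0 (b := b) r; nra.
have := le_seminorm_mul hb (Q v) r; have := le_seminorm_mul hb y (- r).
have := hK r; rewrite (seminormN hb) (semi_innerNr hb).
have h1 : nrm (Q v) * nrm r <= nrm (Q v) * e by rewrite ler_wpM2l ?seminorm_ge0.
have h2 : nrm y * nrm r <= nrm y * e by rewrite ler_wpM2l ?seminorm_ge0.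
have h3 : K * b r r <= K * e by rewrite ler_wpM2l// ltW.
by lra.
Qed.

End Resolvent.

Section GeometricMean.
Context {R : realType} {V : lmodType R} {b : V -> V -> R} (hb : hilbert_form b).
Local Notation nrm := (seminorm b).
Context {A B S : V -> V}.
Hypotheses (pA : positive_for b A) (pB : positive_for b B) (pS : positive_for b
  S).
Hypotheses (AB : forall x, A (B x) = B (A x)) (SS : forall x,
  S (S x) = A (B x)).

Let lA := positive_linear pA.
Let lB := positive_linear pB.
Let lS := positive_linear pS.

Let pAB : positive_for b (A \o B) := positive_comp hb pA pB AB.

Let SB x : B (S x) = S (B x).
Proof.
by apply: (positive_sqrt_comm hb pS SS pAB lB (positive_bounded pB)) => y;
  rewrite /= !AB.
Qed.

Let shift_opC m e x :
  shift_op e B (shift_op m S x) = shift_op m S (shift_op e B x).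
Proof.
rewrite /shift_op (linear_fctD lB) (linear_fctD lS) (linear_fctZ lB)
  (linear_fctZ lS).
by rewrite !scalerDr !scalerA (mulrC e) SB -!addrA; congr (_ + _);
  rewrite addrCA.
Qed.

(* Quantitative form of the inequality [(S + m)^2 > A (B + e)], valid as soon
   as [e * K < m^2] for a bound [K] of [A]. *)
Lemma shifted_sqrt_gt (m e K : R) z : 0 <= m -> 0 <= e ->
    (forall x, b (A x) x <= K * b x x) ->
  b (A (shift_op e B z)) (shift_op e B z) +
    (m ^+ 2 - e * K) * b (shift_op e B z) z <=
  b (shift_op e B (shift_op m S z)) (shift_op m S z).
Proof.
move=> m0 e0 hK; set P := shift_op m S; set T := shift_op e B.
have pT : positive_for b T by exact: positive_shift.
have pP : positive_for b P by exact: positive_shift.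
have TP x : T (P x) = P (T x) by exact: shift_opC.
have PE x : P x = m *: x + S x by [].
have TE x : T x = e *: x + B x by [].
clearbody P T.
have lT := positive_linear pT; have lP := positive_linear pP.
have TS x : T (S x) = S (T x) by rewrite !TE lS SB.
have TA x : T (A x) = A (T x) by rewrite !TE lA AB.
(* The root [r] of [B + e] commutes with [S] and [A], which turns the mixed terms into values of
   positive forms at [r z]. *)
have [r [pr rr rc]] := positive_sqrt hb pT.
have rS x : S (r x) = r (S x) by apply: rc; [|exact: positive_bounded|].
have rA x : A (r x) = r (A x) by apply: rc; [|exact: positive_bounded|].
have Tr x : b (T z) x = b (r z) (r x) by rewrite -rr (positive_sym pr).
have h1 : b (T (P z)) (P z) =
    b (A (B z)) (T z) + 2 * m * b (S (r z)) (r z) + m ^+ 2 * b (T z) z.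
  have PP : P (P z) = m ^+ 2 *: z + (2 * m) *: S z + A (B z).
    rewrite !PE (linear_fctD lS) (linear_fctZ lS) SS scalerDr scalerA.
    by rewrite mulrDl mul1r scalerDl !addrA expr2.
  rewrite TP (positive_sym pP) (semi_innerC hb) PP.
  rewrite !(semi_innerDl hb) !(semi_innerZl hb).
  have -> : b (S z) (T z) = b (S (r z)) (r z).
    by rewrite (semi_innerC hb) Tr rS (semi_innerC hb).
  by rewrite (semi_innerC hb z (T z)); ring.
(* Compared with [h1], what remains is the form of [2 m S + m^2 - e A] at [r z], and [A <= K]. *)
have h2 : b (A (T z)) (T z) = b (A (B z)) (T z) + e * b (A (r z)) (r z).
  rewrite {1}TE (linear_fctD lA) (linear_fctZ lA) !(semi_innerE hb) addrC.
  by rewrite (semi_innerC hb (A z)) Tr rA (semi_innerC hb (r z)).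
have h3 := hK (r z); rewrite -Tr in h3.
have h4 := positive_ge0 pS (r z).
have h5 : 0 <= 2 * m * b (S (r z)) (r z) by rewrite mulr_ge0// mulr_ge0.
have h6 : e * b (A (r z)) (r z) <= e * (K * b (T z) z) by rewrite ler_wpM2l.
by rewrite h1 h2; lra.
Qed.

Context {U : lmodType R} {h : U -> V} {x : U -> U -> R}.
Hypotheses (lh : linear h) (hx : semi_inner x).
Hypothesis hd : forall v e, 0 < e -> exists t, nrm (h t - v) <= e.
Hypothesis xAB : forall u t, 2 * x u t <= b (A (h u)) (h u) + b (B (h t)) (h t).

(* [w = h u] is an approximate eigenvector for the eigenvalue [- m] of [S - x];
   testing [xAB] against [v = (S + m) (B + e)^-1 w] contradicts
   [shifted_sqrt_gt]. *)
Lemma le_geometric_mean u : x u u <= b (S (h u)) (h u).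
Proof.
pose d u t := b (S (h u)) (h t) - x u t; pose N u := b (h u) (h u).
have [KA KA0 hKA] := positive_le hb pA.
have [KB KB0 hKB] := positive_le hb pB.
have [KS KS0 hKS] := positive_le hb pS.
(* The shifts that make [S - x] nonnegative, [d] being its form; restricted to [0 <= m], so that a
   zero infimum is exactly the claim. *)
pose E : set R := [set m : R | 0 <= m /\ forall u, 0 <= d u u + m * N u].
have E0 : E (KA + KB).
  split=> [|t]; first by lra.
  have := xAB t t; have := hKA (h t); have := hKB (h t);
    have := positive_ge0 pS (h t).
  have : 0 <= N t by exact: semi_inner_ge0 hb _.
  by rewrite /d -/(N t); nra.
have hE : has_inf E by split; [exists (KA + KB)|exists 0 => m []].
pose m := inf E.
have m0 : 0 <= m by apply: lb_le_inf; [exists (KA + KB)|move=> ? []].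
have hm t : 0 <= d t t + m * N t.
  have : 0 <= N t by exact: semi_inner_ge0 hb _.
  (* [h] need not be injective, so [N t] may vanish; any member of [E] then gives the bound. *)
  rewrite le_eqVlt => /predU1P[Nt|Nt].
    by have [_ /(_ t)] := E0; rewrite -Nt !mulr0.
  rewrite -lerBlDl sub0r -ler_pdivrMr//; apply: lb_le_inf;
    first by exists (KA + KB).
  by move=> n [_ /(_ t)]; rewrite ler_pdivrMr// -lerBlDl sub0r.
have [mz|mn0] := eqVneq m 0; first by have := hm u;
  rewrite mz mul0r addr0 subr_ge0.
have mp : 0 < m by rewrite lt_def mn0.
exfalso; move: u => _.
(* Half of the margin [m^2] of [shifted_sqrt_gt] is spent on [e * KA]. *)
pose e := m ^+ 2 / (2 * KA).
have e0 : 0 < e by rewrite divr_gt0 ?exprn_gt0// mulr_gt0.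
have eK : m ^+ 2 - e * KA = m ^+ 2 / 2 by rewrite /e; field; rewrite gt_eqF.
pose T := shift_op e B; pose P := shift_op m S.
have pT : positive_for b T by apply: positive_shift => //; exact: ltW.
have pP : positive_for b P by exact: positive_shift.
have [C1 C10 hC1] := bounded_sqr hb (positive_bounded pT).
have [C2 C20 hC2] := bounded_sqr hb (positive_bounded pP).
pose k := m ^+ 2 / 2 * e.
have k0 : 0 < k by rewrite mulr_gt0// divr_gt0// exprn_gt0.
have Te y : e * b y y <= b (T y) y.
  by rewrite /T /shift_op !(semi_innerE hb) lerDl (positive_ge0 pB).
(* [dl] measures how far [u] is from minimising [S - x], and [s] is the size of a perturbation of
   [u]. The fixed positive [k] is bounded by an error that suitable [s] and [dl] make small. *)
have key dl s : 0 < dl -> dl <= m -> 0 < s -> k <= dl / s * C1 + s * (KS + m) *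
  C2.
  move=> dl0 dlm s0.
  have [u ux] : exists u, d u u + (m - dl) * N u < 0.
    apply/not_existsP => nu.
    suff /(ge_inf hE.2) : E (m - dl) by apply/negP;
      rewrite -ltNge /m gtrDl oppr_lt0.
    by split=> [|t]; [rewrite subr_ge0|rewrite leNgt; apply/negP/nu].
  have [z Tz] := coercive_surjective hb (h u) e0 pT Te.
  have hg t : 0 <= N t by exact: semi_inner_ge0 hb _.
  have Nu : 0 < N u by have := hm u; nra.
  (* The nonnegative form of [S + m - x] is below [dl * N u] at [u], so [u] is nearly in its kernel:
     expand it at [u - s *: t] and divide by [s]. The square term in [t] is bounded using
     [0 <= x t t]. *)
  have Ng t : 2 * (b (P (h u)) (h t) - x u t) <= dl / s * N u + s * ((KS + m) *
    N t).
    have := hm (u - s *: t).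
    rewrite /d /N (linear_fctB lh) (linear_fctZ lh) (linear_fctB lS)
      (linear_fctZ lS).
    rewrite !(semi_innerE hb) !(semi_innerE hx) (semi_innerC hx t u)
      (semi_innerC hb (h t) (h u)).
    rewrite (positive_sym pS (h t)) (semi_innerC hb (h t)).
    have -> : dl / s * b (h u) (h u) + s * ((KS + m) * b (h t) (h t)) =
        s^-1 * (dl * b (h u) (h u) + s ^+ 2 * ((KS + m) * b (h t) (h t))).
      by field; rewrite gt_eqF.
    rewrite ler_pdivlMl//; have hS := hKS (h t).
    have : s ^+ 2 * (b (S (h t)) (h t) + m * b (h t) (h t)) <=
           s ^+ 2 * ((KS + m) * b (h t) (h t)).
      by rewrite ler_wpM2l ?sqr_ge0// mulrDl lerD2r.
    have : 0 <= s ^+ 2 * x t t by rewrite mulr_ge0 ?sqr_ge0 ?(semi_inner_ge0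
      hx).
    by move: ux; rewrite /d /N; lra.
  have pQ : positive_for b (shift_op (s * (KS + m)) B).
    by apply: positive_shift => //; rewrite mulr_ge0 ?ltW// addr_gt0.
  (* The sum of [Ng] and [xAB] is free of [x], so density allows [P z] in place of [h t]. *)
  have h1 : 2 * b (P (h u)) (P z) <= (s * (KS + m)) * b (P z) (P z) +
      b (B (P z)) (P z) + (dl / s * N u + b (A (h u)) (h u)).
    rewrite -(semi_innerZl hb (s * (KS + m))) -(semi_innerDl hb _ (B (P z))).
    apply: (dense_quadratic hb hd pQ) => t; have := Ng t; have := xAB u t.
    by rewrite /P /shift_op !(semi_innerDl hb) !(semi_innerZl hb) -/(N t); lra.
  have h2 : b (A (T z)) (T z) + (m ^+ 2 - e * KA) * b (T z) z <= b (T (P z)) (P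
    z).
    by apply: shifted_sqrt_gt => //; exact: ltW.
  rewrite eK Tz in h2.
  have PT : P (h u) = T (P z) by rewrite -Tz; exact/esym/shift_opC.
  have h3 : b (P (h u)) (P z) = e * b (P z) (P z) + b (B (P z)) (P z).
    by rewrite PT -(semi_innerZl hb) -(semi_innerDl hb).
  have h5 : m ^+ 2 / 2 * (e * b z z) <= m ^+ 2 / 2 * b (T z) z.
    by rewrite ler_wpM2l// divr_ge0// sqr_ge0.
  have z0 : 0 < b z z.
    rewrite lt_def (semi_inner_ge0 hb) andbT;
      apply: contraTneq Nu => /(hilbert_def hb) z0.
    by rewrite /N -Tz z0 (linear_fct0 (positive_linear pT)) (semi_inner0l hb)
      ltxx.
  rewrite -(ler_pM2r z0).
  have h6 : dl / s * N u <= dl / s * (C1 * b z z).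
    rewrite ler_wpM2l//; first by rewrite divr_ge0// ltW.
    by rewrite /N -Tz; exact: hC1.
  have h7 : s * (KS + m) * b (P z) (P z) <= s * (KS + m) * (C2 * b z z).
    by rewrite ler_wpM2l// ltW// mulr_gt0// addr_gt0.
  have h8 : 0 <= e * b (P z) (P z) by rewrite mulr_ge0 ?(semi_inner_ge0 hb)//
    ltW.
  (* [h1] bounds the value of [A] at [h u] from below and [h2] from above; together they put
     [m^2 / 2 * b (T z) z] below the two error terms, which [h6] and [h7] express in units of
     [b z z]. *)
  rewrite -PT h3 in h2; rewrite h3 in h1; rewrite /k.
  move: (dl / s) (s * (KS + m)) (m ^+ 2 / 2) h1 h2 h5 h6 h7 => a1 a2 a3.
  by rewrite Tz; lra.
have : k <= k / 2.
  (* [s] makes the second error term [k / 4]; [dl], chosen afterwards, makes the first at most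
     [k / 4]. *)
  pose s := k / (4 * ((KS + m) * C2)).
  pose dl := Num.min m (s * k / (4 * C1)).
  have s0 : 0 < s by rewrite divr_gt0// mulr_gt0// mulr_gt0// addr_gt0.
  have dl0 : 0 < dl by rewrite lt_min mp divr_gt0// mulr_gt0.
  apply: le_trans (key dl s dl0 _ s0) _; first by rewrite ge_min lexx.
  have -> : s * (KS + m) * C2 = k / 4.
    by rewrite /s; field; rewrite !gt_eqF// addr_gt0.
  suff : dl / s * C1 <= k / 4 by lra.
  rewrite -ler_pdivlMr// ler_pdivrMr//.
  apply: le_trans (_ : s * k / (4 * C1) <= _);
    first by rewrite ge_min lexx orbT.
  suff -> : s * k / (4 * C1) = k / 4 / C1 * s by [].
  by field; rewrite gt_eqF.
by lra.
Qed.

End GeometricMean.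

(** * Complex Hilbert spaces as real ones *)

Lemma Re_conj (R : rcfType) (z : R[i]) : Re (Num.conj z) = Re z.
Proof. by case: z. Qed.

Lemma Im_conj (R : rcfType) (z : R[i]) : Im (Num.conj z) = - Im z.
Proof. by case: z. Qed.

Lemma ReM_real (R : rcfType) (a : R) (z : R[i]) : Re (a%:C * z) = a * Re z.
Proof. by case: z => x y /=; rewrite mul0r subr0. Qed.

Lemma Re_iM (R : rcfType) (z : R[i]) : Re ('i * z) = - Im z.
Proof. by case: z => x y /=; rewrite mul0r mul1r sub0r. Qed.

Lemma Im_iM (R : rcfType) (z : R[i]) : Im ('i * z) = Re z.
Proof. by case: z => x y /=; rewrite mul0r mul1r add0r. Qed.

Lemma conj_i (R : rcfType) : Num.conj 'i%C = - 'i%C :> R[i].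
Proof. by apply/eqP; rewrite eq_complex /= oppr0 !eqxx. Qed.

Lemma Re_conjiM (R : rcfType) (z : R[i]) : Re (Num.conj 'i%C * z) = Im z.
Proof. by rewrite conj_i mulNr raddfN /= Re_iM opprK. Qed.

Lemma Im_conjiM (R : rcfType) (z : R[i]) : Im (Num.conj 'i%C * z) = - Re z.
Proof. by rewrite conj_i mulNr raddfN /= Im_iM. Qed.

Definition iM := (Re_iM, Im_iM, Re_conjiM, Im_conjiM).

Lemma ge0_complexP (R : rcfType) (z : R[i]) : 0 <= z <-> 0 <= Re z /\ Im z = 0.
Proof. by rewrite lecE /=; split=> [/andP[/eqP-> ->]|[-> ->]];
  rewrite ?eqxx. Qed.

Section Realification.
Context {R : realType} (V : lmodType R[i]).

(** Convertible to [V], so vectors and operators pass between the real and the complex structure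
    unchanged. *)
Definition realified : Type := V.

HB.instance Definition _ := GRing.Zmodule.on realified.

Let scale (a : R) (x : realified) : realified := (a%:C *: (x : V)).

Let scaleA a b v : scale a (scale b v) = scale (a * b) v.
Proof. by rewrite /scale scalerA rmorphM. Qed.

Let scale1 : left_id 1 scale.
Proof. by move=> v; rewrite /scale scale1r. Qed.

Let scaleDr : right_distributive scale +%R.
Proof. by move=> a u v; rewrite /scale scalerDr. Qed.

Let scaleDl v : {morph scale^~ v : a b / a + b}.
Proof. by move=> a b; rewrite /scale rmorphD scalerDl. Qed.

HB.instance Definition _ :=
  GRing.Zmodule_isLmodule.Build R realified scaleA scale1 scaleDr scaleDl.

Lemma realifiedZ (a : R) (x : realified) : a *: x = a%:C *: (x : V).
Proof. by []. Qed.

End Realification.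

Lemma realified_linear (R : realType) (U V : lmodType R[i]) (T : U -> V) :
  linear T -> linear (T : realified U -> realified V).
Proof. by move=> lT a x y; rewrite realifiedZ lT. Qed.

Lemma linear_realified (R : realType) (U V : lmodType R[i]) (T : U -> V) :
  linear (T : realified U -> realified V) -> (forall x,
    T ('i *: x) = 'i *: T x) ->
  linear T.
Proof.
move=> lT Ti a x y; rewrite [a]complexE.
have TC c z : T (c%:C *: z) = c%:C *: T z by exact: (linear_fctZ lT c z).
have TD z t : T (z + t) = T z + T t by exact: (linear_fctD lT z t).
by rewrite !scalerDl !TD -!scalerA TC Ti TC.
Qed.

(** Polarisation: the vanishing imaginary part of [f] at [x + 'i *: y] is
    [Re (f y x) - Re (f x y)]. *)
Lemma sesquilinear_ReC (R : realType) (V : lmodType R[i]) (f : V -> V -> R[i]) :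
  (forall x y z, f (x + y) z = f x z + f y z) ->
  (forall x y z, f z (x + y) = f z x + f z y) ->
  (forall a x y, f (a *: x) y = a * f x y) ->
  (forall a x y, f x (a *: y) = Num.conj a * f x y) ->
  (forall x, 0 <= f x x) -> forall x y, Re (f x y) = Re (f y x).
Proof.
move=> fDl fDr fZl fZr f0 x y.
have /ge0_complexP[_] := f0 (x + 'i *: y).
have /ge0_complexP[_] := f0 x; have /ge0_complexP[_] := f0 y.
by rewrite !fDl !fDr !fZl !fZr !raddfD /= !iM; lra.
Qed.

Section HilbertSpaces.
Context {R : realType} {H : hilbert R}.
Implicit Types (x y z : H) (T : H -> H).

Definition rdot (x y : realified H) : R := Re (dotp (x : H) (y : H)).

Lemma dotpC x y : dotp x y = Num.conj (dotp y x).
Proof. by rewrite hermC expr0 mul1r. Qed.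

Lemma dotpDl x y z : dotp (x + y) z = dotp x z + dotp y z.
Proof. exact: linearDl. Qed.

Lemma dotpNl x z : dotp (- x) z = - dotp x z.
Proof. exact: linearNl. Qed.

Lemma dotpDr x y z : dotp z (x + y) = dotp z x + dotp z y.
Proof. exact: linearDr. Qed.

Lemma dotpZl a x z : dotp (a *: x) z = a * dotp x z.
Proof. exact: linearZl_LR. Qed.

Lemma dotpZr a x z : dotp z (a *: x) = Num.conj a * dotp z x.
Proof. exact: linearZr_LR. Qed.

Lemma rdot_semi : semi_inner rdot.
Proof.
split=> [a x y z|x y|x].
- by rewrite /rdot realifiedZ dotpDl dotpZl raddfD /= ReM_real.
- by rewrite /rdot dotpC Re_conj.
- by have /ge0_complexP[] := dnorm_ge0 (dotp : {dot H for Num.conj}) x.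
Qed.

Local Notation nrm := (seminorm rdot).

Lemma dotp_sqr x : dotp x x = (rdot x x)%:C.
Proof.
have /ge0_complexP[_ I0] := dnorm_ge0 (dotp : {dot H for Num.conj}) x.
by rewrite [LHS]complexE I0 mulr0 addr0.
Qed.

Lemma normr_seminorm x : `|x| = (nrm x)%:C.
Proof.
apply/eqP; rewrite -(@eqrXn2 _ 2)// ?ler0c ?seminorm_ge0//.
by rewrite normr_dotp dotp_sqr -rmorphXn /= (sqr_seminorm rdot_semi).
Qed.

Lemma rdot_hilbert : hilbert_form rdot.
Proof.
split; first exact: rdot_semi.
- move=> x x0; apply/eqP; rewrite -(dnorm_eq0 (dotp : {dot H for Num.conj})).
  by rewrite dotp_sqr x0.
- move=> u C uC.
  pose v : nat -> H := u.
  have vC m n : (m <= n)%N -> `|v n - v m| <= (C / m.+1%:R)%:C.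
    by move=> mn; rewrite normr_seminorm lecR; exact: uC.
  have : cvg (v @ \oo).
    apply/cauchy_cvgP/cauchy_exP => e e0.
    have [re -> re0] : exists2 r, e = r%:C & 0 < r.
      by move: e0; rewrite ltcE /= => /andP[/eqP Ie re0]; exists (Re e) => //;
        rewrite [LHS]complexE Ie mulr0 addr0.
    have [N hN] : exists N, C / N.+1%:R < re.
      apply/not_existsP => nN; have : re <= 0.
        by apply: (@le0_harmonic _ _ C) => n; rewrite leNgt; apply/negP/nN.
      by rewrite leNgt re0.
    exists (v N); exists N => // n /= Nn; rewrite -ball_normE /= distrC.
    by apply: le_lt_trans (vC _ _ Nn) _; rewrite ltcR.
  move=> vl; exists (lim (v @ \oo)), C => m.
  rewrite -lecR -normr_seminorm -/(v m) distrC.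
  apply/ler_addgt0Pr => e e0.
  have /cvgrPdist_le /(_ _ e0)[N _ hN] := vl.
  have := hN (maxn N m) (leq_maxl _ _) => h1.
  rewrite -(subrKA (v (maxn N m))); apply: le_trans (ler_normD _ _) _.
  by rewrite addrC lerD// vC// leq_maxr.
Qed.

Lemma bounded_opP T : bounded_op T <-> linear T /\ bounded_for rdot T.
Proof.
split=> [[lT cT]|[lT [C C0 hC]]]; split=> //.
- pose T' : {linear H -> H} := HB.pack T (GRing.isLinear.Build _ _ _ _ T lT).
  have : bounded_near T' (nbhs 0) by apply/linear_bounded_continuous.
  move=> /linear_boundedP/pinfty_ex_gt0[r r0 hr].
  have [/= rr0 ri0] : 0 <= Re r /\ Im r = 0 by apply/ge0_complexP/ltW.
  exists (Re r) => // x; rewrite -lecR rmorphM /= -!normr_seminorm.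
  have -> : (Re r)%:C = r by rewrite [RHS]complexE ri0 mulr0 addr0.
  exact: hr.
- pose T' : {linear H -> H} := HB.pack T (GRing.isLinear.Build _ _ _ _ T lT).
  suff : continuous T' by [].
  apply/linear_bounded_continuous/linear_boundedP.
  exists C%:C; split; first by rewrite realE ler0c C0.
  move=> r /ltW Cr x; rewrite !normr_seminorm.
  apply: le_trans (_ : C%:C * (nrm x)%:C <= _).
    by rewrite -rmorphM lecR; exact: hC.
  by rewrite ler_wpM2r// ler0c seminorm_ge0.
Qed.

Lemma dotp_ext T S : linear T -> linear S ->
  (forall x y, rdot (T x) y = rdot x (S y)) -> forall x y,
    dotp (T x) y = dotp x (S y).
Proof.
move=> lT lS TS x y; have h1 := TS x y; have := TS ('i *: x) y.
rewrite /rdot (linear_fctZ lT) !dotpZl; move: h1; rewrite /rdot.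
case: (dotp (T x) y) => a b; case: (dotp x (S y)) => c d /= -> .
by rewrite !mul0r !sub0r !mul1r => /oppr_inj ->.
Qed.

(** [adj] is a choice with default 0, so it is usable only after this. Riesz gives the adjoint for
    the real form; testing at ['i *: z] makes it complex linear. *)
Lemma adj_exists T : bounded_op T ->
  exists S, bounded_op S /\ forall x y, dotp (T x) y = dotp x (S y).
Proof.
move=> /bounded_opP[lT [C C0 hC]].
have lT' := realified_linear lT.
have /boolp.choice[S hS] : forall y, exists z, forall x,
  rdot z x = rdot (T x) y.
  move=> y; apply: (riesz rdot_hilbert (C := C * nrm y)).
    by move=> a x z; rewrite lT' (semi_innerP rdot_semi).
  move=> x; apply: le_trans (le_seminorm_mul rdot_semi _ _) _.
  by rewrite mulrAC ler_wpM2r ?seminorm_ge0//; exact: hC.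
have Sx x y : rdot (T x) y = rdot x (S y).
  by rewrite (semi_innerC rdot_semi x) hS.
have lS' : linear (S : realified H -> realified H).
  move=> a x y; apply: (hilbert_ext rdot_hilbert) => z.
  by rewrite hS !(semi_innerE rdot_semi) !hS.
have lS : linear S.
  apply: linear_realified => // x; apply: (hilbert_ext rdot_hilbert) => z.
  rewrite hS /rdot dotpZr dotpZl.
  have := hS x ('i *: z); rewrite /rdot (linear_fctZ lT) dotpZl dotpZr.
  by rewrite !iM => ->; rewrite opprK.
exists S; split; last exact: dotp_ext.
apply/bounded_opP; split => //; exists C => // x.
have := le_seminorm_mul rdot_semi (T (S x)) x;
  rewrite -hS -(sqr_seminorm rdot_semi).
have := hC (S x); have := seminorm_ge0 (b := rdot) (S x).
have := seminorm_ge0 (b := rdot) x.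
have [->|n0] := eqVneq (nrm (S x)) 0; first by move=> *; rewrite mulr_ge0.
move=> x0 s0 h1 h2; have s1 : 0 < nrm (S x) by rewrite lt_def n0.
rewrite -(ler_pM2r s1) -expr2; apply: le_trans h2 _.
by rewrite mulrAC ler_wpM2r.
Qed.

Lemma adjP T : bounded_op T ->
  bounded_op (adj T) /\ forall x y, dotp (T x) y = dotp x (adj T y).
Proof.
move=> /adj_exists TS.
exact: (xgetPex 0 (TS : exists S, _ S)).
Qed.

Lemma adj_unique T S : bounded_op T ->
  (forall x y, dotp (T x) y = dotp x (S y)) -> adj T = S.
Proof.
move=> /adjP[_ aT] TS; apply/funext => y; apply: (hilbert_ext rdot_hilbert) =>
  x.
by rewrite !(semi_innerC rdot_semi _ x) /rdot -aT TS.
Qed.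

(** Symmetry comes from complex positivity by polarisation. Conversely, symmetry tested at [x] and
    ['i *: x] makes [dotp (T x) x] real. *)
Lemma positive_opP T : positive_op T <-> linear T /\ positive_for rdot T.
Proof.
split=> [[/bounded_opP[lT bT] T0]|[lT pT]].
  split=> //; split=> //; [exact: realified_linear| |].
    move=> x y; rewrite {2}/rdot dotpC Re_conj {1}/rdot.
    apply: (sesquilinear_ReC (f := fun x y => dotp (T x) y)) => //.
    - by move=> ? ? ?; rewrite (linear_fctD lT) dotpDl.
    - by move=> ? ? ?; rewrite dotpDr.
    - by move=> ? ? ?; rewrite (linear_fctZ lT) dotpZl.
    - by move=> ? ? ?; rewrite dotpZr.
  by move=> x; have /ge0_complexP[] := T0 x.
split=> [|x]; first by apply/bounded_opP; split=> //;
  exact: positive_bounded pT.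
apply/ge0_complexP; split; first exact: positive_ge0 pT x.
have := positive_sym pT x ('i *: x); rewrite (linear_fctZ lT) /rdot !dotpZr.
by rewrite (dotpC x (T x)) !iM Im_conj; lra.
Qed.

Lemma op_sqrtP T : positive_op T ->
  positive_op (op_sqrt T) /\ op_sqrt T \o op_sqrt T = T.
Proof.
move=> /positive_opP[lT pT].
suff ex : exists S, positive_op S /\ S \o S = T by exact: (xgetPex 0 (ex :
  exists S, _ S)).
have [S [pS SS Sc]] := positive_sqrt rdot_hilbert pT.
exists S; split; last by apply/funext => x; exact: SS.
apply/positive_opP; split=> //; apply: linear_realified;
  first exact: positive_linear pS.
move=> x; apply/esym.
(* Multiplication by ['i] is a bounded real-linear map commuting with [T], hence with its root. *)
apply: (Sc (fun z : realified H => ('i *: (z : H)) : realified H)).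
- by move=> a u v; rewrite !realifiedZ scalerDr !scalerA mulrC.
- exists 1 => // z; rewrite mul1r /seminorm /rdot dotpZl dotpZr mulrA.
  by rewrite conj_i mulrN -expr2 sqr_i opprK mul1r.
- by move=> z /=; rewrite (linear_fctZ lT).
Qed.

Lemma dense_realified (U : Type) (h : U -> H) : dense (range h) ->
  forall v e, 0 < e -> exists t, nrm (h t - v) <= e.
Proof.
move=> dh v e e0.
have eC : 0 < e%:C :> R[i] by rewrite ltcR.
have [w [bw [t _ tw]]] := dh (ball v e%:C) (ex_intro _ v (ballxx v eC))
  (ball_open v _).
exists t; rewrite -lecR -normr_seminorm; apply/ltW.
by move: bw; rewrite -tw -ball_normE /= distrC.
Qed.

End HilbertSpaces.

(** * Matrices over a von Neumann algebra *)

Section MatricesOfOperators.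
Context {R : realType} {G : hilbert R} {n : nat}.
Implicit Types (T : 'I_n -> 'I_n -> G -> G) (x y : 'I_n -> G).

Definition rdotn (x y : realified ('I_n -> G)) : R := \sum_i rdot (x i) (y i).

Definition mx_op T (x : 'I_n -> G) : 'I_n -> G := fun i => \sum_j T i j (x j).

Definition single (i : 'I_n) (z : G) : 'I_n -> G := fun j =>
  if j == i then z else 0.

Lemma rdotn_semi : semi_inner rdotn.
Proof.
split=> [a x y z|x y|x].
- rewrite /rdotn mulr_sumr -big_split /=; apply: eq_bigr => i _.
  exact: semi_innerP rdot_semi _ _ _ _.
- by apply: eq_bigr => i _; exact: semi_innerC rdot_semi _ _.
- by apply: sumr_ge0 => i _; exact: semi_inner_ge0 rdot_semi _.
Qed.

Local Notation nrm := (seminorm rdot).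
Local Notation nrmn := (seminorm rdotn).

Lemma le_seminorm_tuple x i : nrm (x i) <= nrmn x.
Proof.
rewrite ler_sqrt ?(semi_inner_ge0 rdotn_semi)//.
by rewrite /rdotn (bigD1 i)//= lerDl sumr_ge0// => j _;
  exact: semi_inner_ge0 rdot_semi _.
Qed.

Lemma seminorm_tuple_le x : nrmn x <= \sum_i nrm (x i).
Proof.
have s0 : 0 <= \sum_i nrm (x i) by apply: sumr_ge0 => i _; exact: seminorm_ge0.
rewrite (seminorm_le rdotn_semi)// expr2 mulr_suml; apply: ler_sum => i _.
rewrite -(sqr_seminorm rdot_semi) expr2 ler_wpM2l ?seminorm_ge0//.
by rewrite (bigD1 i)//= lerDl sumr_ge0// => j _; exact: seminorm_ge0.
Qed.

Lemma rdotn_hilbert : hilbert_form rdotn.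
Proof.
split; first exact: rdotn_semi.
- move=> x /eqP; rewrite psumr_eq0 => [/allP x0|i _];
    last exact: semi_inner_ge0 rdot_semi _.
  apply/funext => i; apply: (hilbert_def rdot_hilbert).
  by apply/eqP/(implyP (x0 i _)); rewrite ?mem_index_enum.
- move=> u C uC.
  have /boolp.choice[l hl] : forall i, exists l, exists C', forall k,
      nrm ((u k : 'I_n -> G) i - l) <= C' / k.+1%:R.
    move=> i; apply: (hilbert_complete rdot_hilbert (C := C)) => k m km.
    by apply: le_trans (uC _ _ km); exact: (le_seminorm_tuple (u m - u k) i).
  have /boolp.choice[C' hC'] := hl.
  exists l, (\sum_i C' i) => k; apply: le_trans (seminorm_tuple_le _) _.
  by rewrite mulr_suml; apply: ler_sum => i _; exact: hC'.
Qed.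

Lemma mx_op_linear T : (forall i j, linear (T i j)) -> linear (mx_op T).
Proof.
move=> lT a x y; apply/funext => i; rewrite /mx_op !fctE scaler_sumr -big_split
  /=.
by apply: eq_bigr => j _; exact: lT.
Qed.

Lemma mx_op_bounded T : (forall i j, bounded_op (T i j)) ->
  bounded_for rdotn (mx_op T : realified ('I_n -> G) -> realified ('I_n -> G)).
Proof.
move=> bT.
have /boolp.choice[C hC] : forall ij : 'I_n * 'I_n, exists C, 0 <= C /\
    forall z, nrm (T ij.1 ij.2 z) <= C * nrm z.
  by move=> ij; have /bounded_opP[_ [C C0 hC]] := bT ij.1 ij.2; exists C.
exists (\sum_i \sum_j C (i, j)) => [|x].
  by apply: sumr_ge0 => i _; apply: sumr_ge0 => j _; case: (hC (i, j)).
apply: le_trans (seminorm_tuple_le _) _; rewrite mulr_suml;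
  apply: ler_sum => i _.
rewrite mulr_suml /mx_op.
apply: (@le_trans _ _ (\sum_j nrm (T i j ((x : 'I_n -> G) j)))).
  elim/big_ind2: _ => [|a b c d ab cd|//].
    by rewrite /seminorm (semi_inner0l rdot_semi) sqrtr0.
  by apply: le_trans (seminormD rdot_semi _ _) _; exact: lerD.
apply: ler_sum => j _; have [C0 h] := hC (i, j).
by apply: le_trans (h _) _; rewrite ler_wpM2l//; exact: (le_seminorm_tuple x j).
Qed.

Lemma mx_op_positive T : (forall i j, bounded_op (T i j)) ->
  (forall x : 'I_n -> G, 0 <= \sum_i \sum_j dotp (T i j (x j)) (x i)) ->
  positive_for rdotn (mx_op T : realified ('I_n -> G) -> realified ('I_n -> G)).
Proof.
move=> bT T0.
have lT i j : linear (T i j) by case: (bT i j).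
have lmT := mx_op_linear lT.
pose f (x y : 'I_n -> G) := \sum_i dotp (mx_op T x i) (y i).
have f0 x : 0 <= f x x.
  suff -> : f x x = \sum_i \sum_j dotp (T i j (x j)) (x i) by exact: T0.
  apply: eq_bigr => i _; rewrite /mx_op.
  exact: (big_morph (fun u => dotp u (x i)) (fun u v => dotpDl u v _) (linear0l
    _ _)).
have fE x y : rdotn (mx_op T x) y = Re (f x y).
  by rewrite /f raddf_sum.
split.
- exact: realified_linear lmT.
- move=> x y; rewrite (semi_innerC rdotn_semi x) !fE.
  apply: sesquilinear_ReC => //.
  + by move=> u v w; rewrite /f (linear_fctD lmT) -big_split;
      apply: eq_bigr => i _; exact: dotpDl.
  + by move=> u v w; rewrite /f -big_split; apply: eq_bigr => i _;
      exact: dotpDr.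
  + by move=> a u v; rewrite /f (linear_fctZ lmT) mulr_sumr;
      apply: eq_bigr => i _; exact: dotpZl.
  + by move=> a u v; rewrite /f mulr_sumr; apply: eq_bigr => i _; exact: dotpZr.
- by move=> x; rewrite fE; have /ge0_complexP[] := f0 x.
- exact: mx_op_bounded.
Qed.

Lemma single_linear i : linear (single i).
Proof.
move=> a x y; apply/funext => j; rewrite /single !fctE.
by case: ifP => //; rewrite scaler0 addr0.
Qed.

Lemma rdotn_single x i z : rdotn x (single i z) = rdot (x i) z.
Proof.
rewrite /rdotn (bigD1 i)//= /single eqxx big1 ?addr0// => j /negPf ->.
by rewrite (semi_innerC rdot_semi) (semi_inner0l rdot_semi).
Qed.

Lemma tuple_sum_single x : x = \sum_i single i (x i).
Proof.
apply/funext => i; rewrite fct_sumE (bigD1 i)//= {1}/single eqxx big1 ?addr0//.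
by move=> j /negPf ji; rewrite /single eq_sym ji.
Qed.

(* The square root of [T] in [M_n(B(G))] commutes with the diagonal operators
   [diag(C, .., C)], [C] in the commutant of [A], hence has entries in [A]. *)
Lemma von_neumann_mx_sqrt (A : set (G -> G)) T : von_neumann A ->
  (forall i j, A (T i j)) ->
  (forall x : 'I_n -> G, 0 <= \sum_i \sum_j dotp (T i j (x j)) (x i)) ->
  exists W : 'I_n -> 'I_n -> G -> G, (forall i j, A (W i j)) /\
    forall i j, T i j = fun z => \sum_k adj (W k i) (W k j z).
Proof.
move=> [_ AA] AT T0.
have bA U : A U -> bounded_op U by rewrite -AA => -[].
have bT i j : bounded_op (T i j) by exact: bA.
have lT i j : linear (T i j) by case: (bT i j).
have [S [pS SS Sc]] := positive_sqrt rdotn_hilbert (mx_op_positive bT T0).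
have lS := positive_linear pS.
pose W i j z : G := S (single j z) i.
(* Used twice: multiplication by ['i] as [C] makes the entries complex linear, and [C] in the
   commutant puts them into [A]. *)
have Wc (C : G -> G) : linear C -> bounded_for rdot C ->
    (forall U, A U -> forall z, U (C z) = C (U z)) -> forall i j z,
      C (W i j z) = W i j (C z).
  move=> lC [K K0 hK] cC i j z.
  pose E (x : realified ('I_n -> G)) : realified ('I_n -> G) := fun i =>
    C ((x : 'I_n -> G) i).
  have cE : forall x, E (S x) = S (E x).
    apply: Sc.
    - by move=> a x y; apply/funext => k; exact: (lC a%:C).
    - exists K => // x; rewrite (seminorm_le rdotn_semi) ?mulr_ge0
        ?seminorm_ge0//.
      rewrite exprMn (sqr_seminorm rdotn_semi) mulr_sumr; apply: ler_sum => k _.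
      have := hK ((x : 'I_n -> G) k); rewrite (seminorm_le rdot_semi) ?mulr_ge0
        ?seminorm_ge0//.
      by rewrite exprMn (sqr_seminorm rdot_semi).
    - move=> x; apply/funext => k; rewrite /E /mx_op.
      rewrite (big_morph C (linear_fctD lC) (linear_fct0 lC)).
      by apply: eq_bigr => m _; rewrite (cC _ (AT k m)).
  apply: etrans (congr1 (fun x : 'I_n -> G => x i) (cE (single j z))) _.
  congr (S _ i); apply/funext => k; rewrite /E /single.
  by case: ifP => // _; exact: linear_fct0.
have lWr i j : linear (W i j : realified G -> realified G).
  move=> a x y; rewrite /W.
  have -> : single j (a *: x + y) = (a *: (single j x : realified _) + (single
    j y : realified _)).
    exact: (single_linear j a%:C).
  by rewrite lS.
have lW i j : linear (W i j).
  apply: linear_realified => // z; apply/esym.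
  apply: (Wc (fun z => 'i *: z)).
  - by move=> a u v; rewrite scalerDr !scalerA mulrC.
  - exists 1 => // x; rewrite mul1r /seminorm /rdot dotpZl dotpZr mulrA.
    by rewrite conj_i mulrN -expr2 sqr_i opprK mul1r.
  - by move=> U /bA[lU _] x; rewrite (linear_fctZ lU).
have bW i j : bounded_op (W i j).
  apply/bounded_opP; split => //; have [K K0 hK] := positive_bounded pS.
  exists K => // z; apply: le_trans (le_seminorm_tuple _ i) _.
  apply: le_trans (hK _) _; rewrite ler_wpM2l//.
  apply: le_trans (seminorm_tuple_le _) _; rewrite (bigD1 j)//= /single eqxx
    big1 ?addr0//.
  by move=> k /negPf ->; rewrite /seminorm (semi_inner0l rdot_semi) sqrtr0.
have AW i j : A (W i j).
  rewrite -AA; split=> // C [/bounded_opP[lC bC] cC]; apply/funext => z /=.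
  apply/esym/Wc => // U AU x; exact/esym/(congr1 (@^~ x) (cC U AU)).
exists W; split=> // i j.
(* [S] is symmetric, so [W] is its own conjugate transpose and [S^2 = T] reads as the required
   factorisation. *)
have aW k : adj (W k i) = W i k.
  apply: adj_unique => // x y; apply: dotp_ext => // {}x {}y.
  rewrite -rdotn_single (positive_sym pS) (semi_innerC rdotn_semi).
  by rewrite rdotn_single (semi_innerC rdot_semi).
apply/funext => z; under eq_bigr do rewrite aW.
have := SS (single j z) => /(congr1 (fun x : 'I_n -> G => x i)) /=.
have -> : mx_op T (single j z) i = T i j z.
  rewrite /mx_op (bigD1 j)//= /single eqxx big1 ?addr0// => k /negPf ->.
  exact: linear_fct0.
move=> <-; rewrite {1}(tuple_sum_single (S (single j z))).
rewrite (big_morph S (linear_fctD lS) (linear_fct0 lS)).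
exact: (congr1 (fun x : 'I_n -> G => x i) (fct_sumE _ _ _)).
Qed.

End MatricesOfOperators.

Lemma dotp_sumDl (R : realType) (H : hilbert R) I r (P : pred I) (f : I ->
  H) (z : H) :
  dotp (\sum_(i <- r | P i) f i) z = \sum_(i <- r | P i) dotp (f i) z.
Proof.
exact: (big_morph (fun u => dotp u z) (fun u v => dotpDl u v z) (linear0l _ z)).
Qed.

Lemma dotp_sumDr (R : realType) (H : hilbert R) I r (P : pred I) (f : I ->
  H) (z : H) :
  dotp z (\sum_(i <- r | P i) f i) = \sum_(i <- r | P i) dotp z (f i).
Proof. exact: linear_sumr. Qed.

Lemma dotp_adjl (R : realType) (H : hilbert R) (T : H -> H) x y : bounded_op T
  ->
  dotp (adj T x) y = dotp x (T y).
Proof. by move=> /adjP[_ aT]; rewrite dotpC -aT -dotpC. Qed.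

Lemma gram_ge0 (R : realType) (H : hilbert R) n (W : 'I_n -> 'I_n -> H -> H)
    (x : 'I_n -> H) : (forall i j, bounded_op (W i j)) ->
  0 <= \sum_i \sum_j dotp (\sum_k adj (W k i) (W k j (x j))) (x i).
Proof.
move=> bW.
suff -> : \sum_i \sum_j dotp (\sum_k adj (W k i) (W k j (x j))) (x i) =
    \sum_k dotp (\sum_j W k j (x j)) (\sum_i W k i (x i)).
  by apply: sumr_ge0 => k _; exact: dnorm_ge0.
under eq_bigr do under eq_bigr do rewrite dotp_sumDl.
under eq_bigr do rewrite exchange_big /=.
rewrite exchange_big /=; apply: eq_bigr => k _.
rewrite dotp_sumDr; apply: eq_bigr => i _; rewrite dotp_sumDl;
  apply: eq_bigr => j _.
exact: dotp_adjl.
Qed.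

(** * Positivity of matrices in terms of the algebra operations *)

Section Algebra.
Context {R : realType} {H : hilbert R} {M : vnalgebra H}.
Implicit Types x y : M.

Lemma vn_bounded x : bounded_op x.
Proof. by have := vn_eltP x; rewrite -vn_bicommutant => -[]. Qed.

Lemma vn_op_sum I r (P : pred I) (f : I -> M) z :
  (\sum_(i <- r | P i) f i : M) z = \sum_(i <- r | P i) f i z.
Proof. by rewrite /vn_op raddf_sum fct_sumE. Qed.

Definition gram n (w : 'I_n -> 'I_n -> M) (i j : 'I_n) : M :=
  \sum_k vn_mul (vn_star (w k i)) (w k j).

Lemma mx_positiveP n (X : 'M[M]_n) : mx_positive X <->
  exists w, forall i j, X i j = gram w i j.
Proof.
split=> [X0|[w Xw] xi].
  have [W [AW WE]] := von_neumann_mx_sqrt (vn_setP M) (fun i j =>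
    vn_eltP (X i j)) X0.
  pose w i j : M := exist _ (W i j) (mem_set (AW i j)).
  exists w => i j; apply: val_inj; apply/funext => z.
  by rewrite -[LHS]/(vn_op (X i j) z) -[RHS]/(vn_op (gram w i j) z) WE
    vn_op_sum.
under eq_bigr do under eq_bigr do rewrite Xw vn_op_sum.
by apply: (gram_ge0 (W := fun i j => vn_op (w i j))) => i j; exact: vn_bounded.
Qed.

Context (L : standard_form M).

Let repT x : range (sf_rep L) (sf_rep L x). Proof. by exists x. Qed.

Lemma sf_bounded x : bounded_op (sf_rep L x).
Proof. by have [_ E] := sf_rep_von_neumann L; have := repT x;
  rewrite -E => -[]. Qed.

Lemma sf_rep_sum I r (P : pred I) (f : I -> M) z :
  sf_rep L (\sum_(i <- r | P i) f i) z = \sum_(i <- r | P i) sf_rep L (f i) z.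
Proof.
have lL := @sf_rep_linear _ _ _ L.
by rewrite (big_morph _ (linear_fctD lL) (linear_fct0 lL)) fct_sumE.
Qed.

Lemma sf_rep_gram n (w : 'I_n -> 'I_n -> M) i j z :
  sf_rep L (gram w i j) z = \sum_k adj (sf_rep L (w k i)) (sf_rep L (w k j) z).
Proof.
rewrite sf_rep_sum; apply: eq_bigr => k _.
by rewrite sf_repM sf_rep_star.
Qed.

Lemma mx_positive_repP n (X : 'M[M]_n) : mx_positive X <->
  forall xi : 'I_n -> L, 0 <= \sum_i \sum_j dotp (sf_rep L (X i j) (xi j)) (xi
    i).
Proof.
split=> [/mx_positiveP[w Xw] xi|X0].
  under eq_bigr do under eq_bigr do rewrite Xw sf_rep_gram.
  by apply: (gram_ge0 (W := fun i j => sf_rep L (w i j))) => i j;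
    exact: sf_bounded.
have [W [AW WE]] := von_neumann_mx_sqrt (sf_rep_von_neumann L) (fun i j =>
  repT (X i j)) X0.
have /boolp.choice[w wW] : forall ij : 'I_n * 'I_n, exists x,
  sf_rep L x = W ij.1 ij.2.
  by move=> ij; have [x _ xW] := AW ij.1 ij.2; exists x.
apply/mx_positiveP; exists (fun i j => w (i, j)) => i j.
apply: (@sf_rep_inj _ _ _ L); apply/funext => z; rewrite WE sf_rep_gram.
by apply: eq_bigr => k _; rewrite !wW.
Qed.

End Algebra.

(** * Completely positive maps and forms on the tensor product *)

Section Tensors.
Context {R : realType} {U V : lmodType R[i]} {K : hilbert R}.

Lemma tensor_sum (t : tensor U V) :
  exists n (x : 'I_n -> U) (xi : 'I_n -> V), t = \sum_i tens (x i) (xi i).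
Proof.
have /asboolP[s st] := valP t.
exists (size s), (fun i => (tnth (in_tuple s) i).1),
  (fun i => (tnth (in_tuple s) i).2).
apply: val_inj; rewrite [LHS]st [LHS]big_tnth raddf_sum.
by [].
Qed.

Variable g : U -> V -> K.
Hypotheses (gl : forall v, linear (g^~ v)) (gr : forall u, linear (g u)).

Definition pairing (z : K) (u : U) (v : V) : R[i]^o := dotp (g u v) z.

Lemma pairing_bilinear z : bilinear_for
  (GRing.Scale.Law.clone _ _ *:%R _) (GRing.Scale.Law.clone _ _ *:%R _)
    (pairing z).
Proof.
split=> [v a u u'|u a v v']; rewrite /pairing.
  by rewrite gl dotpDl dotpZl.
by rewrite gr dotpDl dotpZl.
Qed.

HB.instance Definition _ z := bilinear_isBilinear.Build R[i] U V R[i]^o _ _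
  (pairing z) (pairing_bilinear z).

(** A tensor is a functional on bilinear forms, so its value at [pairing z] prescribes
    [dotp (p t) z]. This determines [p t] independently of how [t] is written as a sum. *)
Lemma tensor_lift : exists p : tensor U V -> K, linear p /\
  forall u v, p (tens u v) = g u v.
Proof.
have /boolp.choice[p hp] : forall t : tensor U V, exists y : K, forall z : K,
    dotp y z = val t (pairing z : {bilinear U -> V -> R[i]^o}).
  move=> t; have [n [x [xi ->]]] := tensor_sum t.
  exists (\sum_i g (x i) (xi i)) => z.
  by rewrite raddf_sum /= fct_sumE dotp_sumDl.
have ext (y y' : K) : (forall z, dotp y z = dotp y' z) -> y = y'.
  by move=> yy; apply: (hilbert_ext rdot_hilbert) => z; rewrite /rdot yy.
exists p; split=> [a t t'|u v]; apply: ext => z.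
  by rewrite dotpDl dotpZl !hp linearP.
by rewrite hp.
Qed.

End Tensors.

Section Forms.
Context {R : realType} {H : hilbert R} {M : vnalgebra H} (L : standard_form M).
Implicit Types Phi Psi : M -> M.

Lemma cp_form_sum Phi s n (x : 'I_n -> M) (xi : 'I_n -> L) : cp_form (L2N := L)
  Phi s ->
  s (\sum_i tens (x i) (xi i)) (\sum_i tens (x i) (xi i)) =
  \sum_i \sum_j dotp (sf_rep L (Phi (vn_mul (vn_star (x i)) (x j))) (xi j)) (xi
    i).
Proof.
move=> [[sl sr] sE].
have sDl y t t' : s (t + t') y = s t y + s t' y by exact: (linear_fctD (sl y)).
have s0l y : s 0 y = 0 by exact: (linear_fct0 (sl y)).
have sDr y t t' : s y (t + t') = s y t + s y t'.
  by have := sr y 1 t t'; rewrite scale1r /= rmorph1 mul1r.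
have s0r y : s y 0 = 0 by apply: (addrI (s y 0)); rewrite -sDr !addr0.
rewrite (big_morph (s _) (sDr _) (s0r _)); apply: eq_bigr => i _.
rewrite (big_morph (s^~ _) (sDl _) (s0l _)); apply: eq_bigr => j _.
exact: sE.
Qed.

(** The matrix with entries [x_i^* x_j] is positive; [s t t] evaluates its image under [Phi] at the
    vectors [xi] of [L]. *)
Lemma cp_form_ge0 Phi s : CP Phi -> cp_form (L2N := L) Phi s -> forall t,
  0 <= s t t.
Proof.
move=> [_ cp] fs t; have [n [x [xi ->]]] := tensor_sum t.
rewrite (cp_form_sum _ _ fs).
pose X : 'M[M]_n := \matrix_(i, j) vn_mul (vn_star (x i)) (x j).
have X0 : mx_positive X.
  move=> z; under eq_bigr do under eq_bigr do rewrite mxE.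
  suff -> : \sum_i \sum_j dotp (vn_op (vn_mul (vn_star (x i)) (x j)) (z j)) (z
    i) =
      dotp (\sum_j vn_op (x j) (z j)) (\sum_i vn_op (x i) (z i)) by exact:
        dnorm_ge0.
  rewrite dotp_sumDr; apply: eq_bigr => i _; rewrite dotp_sumDl;
    apply: eq_bigr => j _.
  by apply: dotp_adjl; exact: vn_bounded.
have := (mx_positive_repP L _).1 (cp _ _ X0) xi.
by under eq_bigr do under eq_bigr do rewrite !mxE.
Qed.

(** Factor a positive matrix as [w^* w]: each row [k] of [w] contributes the value of [s] at the
    tensor built from [w k j] and [xi j]. *)
Lemma CP_of_form Phi s : linear Phi -> cp_form (L2N := L) Phi s ->
  (forall t, 0 <= s t t) -> CP Phi.
Proof.
move=> lPhi fs s0; split=> // n X /mx_positiveP[w Xw].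
apply/(mx_positive_repP L) => xi.
suff -> : \sum_i \sum_j dotp (sf_rep L (map_mx Phi X i j) (xi j)) (xi i) =
    \sum_k s (\sum_j tens (w k j) (xi j)) (\sum_j tens (w k j) (xi j)).
  by apply: sumr_ge0 => k _.
under [RHS]eq_bigr do rewrite (cp_form_sum _ _ fs).
rewrite [RHS]exchange_big /=; apply: eq_bigr => i _.
rewrite [RHS]exchange_big /=; apply: eq_bigr => j _.
rewrite mxE Xw /gram (big_morph Phi (linear_fctD lPhi) (linear_fct0 lPhi)).
by rewrite sf_rep_sum dotp_sumDl.
Qed.

Lemma cp_form_lin Phi Psi s s' (a : R) : cp_form (L2N := L) Phi s ->
  cp_form (L2N := L) Psi s' ->
  cp_form (L2N := L) (Phi - a%:C *: Psi) (fun t t' => s t t' - a%:C * s' t t').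
Proof.
move=> [[sl sr] sE] [[sl' sr'] sE']; have lL := @sf_rep_linear _ _ _ L.
split; first split.
- move=> y c t t'; rewrite (sl y c t t') (sl' y c t t') /=; ring.
- move=> y c t t'; rewrite (sr y c t t') (sr' y c t t') /=; ring.
- move=> x y xi eta; rewrite sE sE' !fctE (linear_fctB lL) (linear_fctZ lL)
    !fctE.
  by rewrite dotpDl dotpNl dotpZl.
Qed.

(* The identity map corresponds to the form [<p t, p t'>] with
   [p (x (x) xi) = x xi]. *)
Lemma cp_form_idfun : exists p : tensor M L -> L, linear p /\
  cp_form (L2N := L) idfun (fun t t' => dotp (p t) (p t')).
Proof.
have lL := @sf_rep_linear _ _ _ L.
have [||p [lp pE]] := tensor_lift (g := fun (x : M) (xi : L) => sf_rep L x xi).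
- by move=> v a u u'; rewrite lL.
- by move=> u; case: (sf_bounded L u).
exists p; split=> //; split; first split.
- by move=> y a t t'; rewrite lp dotpDl dotpZl.
- by move=> y a t t'; rewrite lp dotpDr dotpZr.
- move=> x y xi eta; rewrite !pE sf_repM sf_rep_star /= dotp_adjl//.
  exact: sf_bounded.
Qed.

End Forms.

(** * The lower bound and the index *)

Lemma CP_scale (R : realType) (H : hilbert R) (M : vnalgebra H) (a : R) (Phi :
  M -> M) :
  0 <= a -> CP Phi -> CP (a%:C *: Phi).
Proof.
move=> a0 [lPhi cp]; split=> [c x y|n X X0 xi].
  by rewrite !fctE lPhi scalerDr !scalerA mulrC.
suff -> : \sum_i \sum_j dotp (vn_op (map_mx (a%:C *: Phi) X i j) (xi j)) (xi i)
  =
    a%:C * \sum_i \sum_j dotp (vn_op (map_mx Phi X i j) (xi j)) (xi i).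
  by apply: mulr_ge0; [rewrite ler0c|exact: cp].
rewrite mulr_sumr; apply: eq_bigr => i _; rewrite mulr_sumr;
  apply: eq_bigr => j _.
by rewrite !mxE -dotpZl.
Qed.

Section GeometricMeanLowerBound.
Context {R : realType} {V : lmodType R[i]} {K : hilbert R}.

Lemma form_gmean_lower (alpha beta gamma : V -> V -> R[i]) (p : V ->
  K) (l1 l2 : R) :
  form_gmean alpha beta gamma -> linear p -> 0 <= l1 -> 0 <= l2 ->
  (forall t, 0 <= alpha t t - l1%:C * dotp (p t) (p t)) ->
  (forall t, 0 <= beta t t - l2%:C * dotp (p t) (p t)) ->
  sesquilinear gamma /\
  forall t, 0 <= gamma t t - (Num.sqrt (l1 * l2))%:C * dotp (p t) (p t).
Proof.
move=> [r gE] lp l10 l20 h1 h2.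
have lh := cr_map_linear r.
have /positive_opP[lA pA] := cr_A_positive r.
have /positive_opP[lB pB] := cr_B_positive r.
have AB x : cr_A r (cr_B r x) = cr_B r (cr_A r x) by have /= := congr1 (@^~ x)
  (cr_AB_comm r).
have pAB : positive_op (cr_A r \o cr_B r).
  apply/positive_opP; split; first by move=> a x y; rewrite /= lB lA.
  exact: (positive_comp rdot_hilbert).
have [/[dup] [[_ pS']] /positive_opP[lS pS] SS] := op_sqrtP pAB.
have SS' z : op_sqrt (cr_A r \o cr_B r) (op_sqrt (cr_A r \o cr_B r) z) =
    cr_A r (cr_B r z) by have /= := congr1 (@^~ z) SS.
split.
  split=> [y a x z|x a y z]; rewrite !gE.
    by rewrite lh lS dotpDl dotpZl.
  by rewrite lh dotpDr dotpZr.
pose c := Num.sqrt (l1 * l2).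
pose x (t t' : realified V) : R := c * rdot (p t) (p t').
have xE : semi_inner x.
  split=> [a u v w|u v|u]; rewrite /x.
  - rewrite (realified_linear lp a u v) (semi_innerP rdot_semi) /x; ring.
  - by rewrite (semi_innerC rdot_semi).
  - by rewrite mulr_ge0 ?sqrtr_ge0// (semi_inner_ge0 rdot_semi).
have Re_le (a : R[i]) (l : R) t : 0 <= a - l%:C * dotp (p t) (p t) ->
    l * rdot (p t) (p t) <= Re a.
  by move=> /ge0_complexP[+ _]; rewrite raddfB /= ReM_real subr_ge0.
(* The square norm of [sqrt l1 p u - sqrt l2 p t] is nonnegative. This passes from the diagonal
   bounds on [alpha] and [beta] to a bound in two variables. *)
have amgm u t : 2 * x u t <= l1 * rdot (p u) (p u) + l2 * rdot (p t) (p t).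
  rewrite /x /c sqrtrM//.
  have := semi_inner_ge0 rdot_semi ((Num.sqrt l1 *: (p u : realified K) -
    Num.sqrt l2 *: (p t : realified K))).
  rewrite !(semi_innerE rdot_semi) (semi_innerC rdot_semi (p t) (p u)).
  move: (sqr_sqrtr l10) (sqr_sqrtr l20).
  by move: (Num.sqrt l1) (Num.sqrt l2) => a b <- <-; lra.
move=> t; apply/ge0_complexP.
have Ig : Im (gamma t t) = 0.
  by rewrite gE; have /ge0_complexP[_ ->] := pS' (cr_map r t).
split; last by rewrite raddfB /= Ig dotp_sqr -rmorphM /= subrr.
rewrite raddfB /= ReM_real subr_ge0 gE.
apply: (le_geometric_mean rdot_hilbert pA pB pS AB SS'
  (realified_linear lh) xE (dense_realified (@cr_map_dense _ _ _ _ r)) _ t) =>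
    u t'.
apply: le_trans (amgm u t') _; apply: lerD.
  by rewrite /rdot -(cr_A_form r); exact: Re_le.
by rewrite /rdot -(cr_B_form r); exact: Re_le.
Qed.

End GeometricMeanLowerBound.

Section IndexBounds.
Context {R : realType} {H : hilbert R} {M : vnalgebra H}.
Implicit Types Phi Psi Theta : M -> M.

Lemma cp_gmean_lower (L : standard_form M) Phi Psi Theta (l1 l2 : R) :
  cp_gmean L Phi Psi Theta -> 0 <= l1 -> 0 <= l2 ->
  le_cp (l1%:C *: (idfun : M -> M)) Phi -> le_cp (l2%:C *: (idfun : M ->
    M)) Psi ->
  le_cp ((Num.sqrt (l1 * l2))%:C *: (idfun : M -> M)) Theta.
Proof.
move=> [[lT _] [s1 [s2 [s [f1 f2 gm sE]]]]] l10 l20 cp1 cp2.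
have [p [lp fp]] := cp_form_idfun L.
have h1 := cp_form_ge0 cp1 (cp_form_lin l1 f1 fp).
have h2 := cp_form_ge0 cp2 (cp_form_lin l2 f2 fp).
have [ss h] := form_gmean_lower gm lp l10 l20 h1 h2.
apply: CP_of_form (cp_form_lin _ _ fp) h; last by split.
move=> a x y; rewrite !fctE lT /= scalerBr scalerDr !scalerA (mulrC a).
by rewrite opprD addrACA.
Qed.

(** Converts a competitor [l] in the index into a lower bound [1 / l] of [Phi]. *)
Lemma le_cp_inv Phi (l : R) : 0 < l ->
  le_cp idfun (l%:C *: Phi) <-> le_cp (l^-1%:C *: (idfun : M -> M)) Phi.
Proof.
move=> l0; have lC : l%:C != 0 :> R[i] by rewrite eq_complex /= gt_eqF.
rewrite /le_cp; split=> h.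
- have -> : Phi - l^-1%:C *: idfun = l^-1%:C *: (l%:C *: Phi - idfun).
    by rewrite scalerBr scalerA -rmorphM /= mulVf ?gt_eqF// scale1r.
  by apply: CP_scale => //; rewrite invr_ge0 ltW.
- have -> : l%:C *: Phi - idfun = l%:C *: (Phi - l^-1%:C *: idfun).
    by rewrite scalerBr scalerA -rmorphM /= mulfV ?gt_eqF// scale1r.
  by apply: CP_scale => //; exact: ltW.
Qed.

Lemma Ind_cp_ge0 Phi : (0 <= Ind_cp Phi)%E.
Proof. by apply/ereal_infP => _ [l [l0 _] <-]; rewrite lee_fin ltW. Qed.

Lemma Ind_cp_fin Phi : (Ind_cp Phi < +oo)%E -> exists2 a,
  Ind_cp Phi = a%:E & 0 <= a.
Proof.
have := Ind_cp_ge0 Phi; case: (Ind_cp Phi) => //= a a0 _.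
by exists a.
Qed.

Lemma Ind_cp_nonempty Phi : (Ind_cp Phi < +oo)%E ->
  exists2 l : R, 0 < l & le_cp idfun (l%:C *: Phi).
Proof.
move=> /ereal_inf_lt[_ [l [l0 lPhi] <-] _]; by exists l.
Qed.

Lemma Ind_cp_ge Phi (a : R) :
  (forall l : R, 0 < l -> le_cp idfun (l%:C *: Phi) -> a <= l) ->
    (a%:E <= Ind_cp Phi)%E.
Proof. by move=> h; apply/ereal_infP => _ [l [l0 lP] <-];
  rewrite lee_fin h. Qed.

Lemma Ind_cp_le Phi (l : R) : 0 < l -> le_cp idfun (l%:C *: Phi) ->
  (Ind_cp Phi <= l%:E)%E.
Proof. by move=> l0 h; apply: ereal_inf_lbound; exists l. Qed.

End IndexBounds.

Theorem proposition5p4 (R : realType) (H : hilbert R) (M : vnalgebra H)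
    (L2M : standard_form M) (Phi1 Phi2 Phi12 : M -> M)
    (CP1 : CP Phi1) (CP2 : CP Phi2) (gmean12 : cp_gmean L2M Phi1 Phi2 Phi12) :
  (forall lambda1 lambda2 : R, 0 < lambda1 -> 0 < lambda2 ->
     le_cp (lambda1%:C *: (idfun : M -> M)) Phi1 ->
     le_cp (lambda2%:C *: (idfun : M -> M)) Phi2 ->
     le_cp ((Num.sqrt (lambda1 * lambda2))%:C *: (idfun : M -> M)) Phi12) /\
  ((Ind_cp Phi1 < +oo)%E -> (Ind_cp Phi2 < +oo)%E ->
     (Ind_cp Phi12 <= sqrte (Ind_cp Phi1 * Ind_cp Phi2))%E).
Proof.
have lower (l1 l2 : R) : 0 < l1 -> 0 < l2 ->
    le_cp (l1%:C *: (idfun : M -> M)) Phi1 ->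
    le_cp (l2%:C *: (idfun : M -> M)) Phi2 ->
    le_cp ((Num.sqrt (l1 * l2))%:C *: (idfun : M -> M)) Phi12.
  by move=> /ltW l10 /ltW l20; exact: cp_gmean_lower gmean12 l10 l20.
split=> // fin1 fin2.
have bound (l1 l2 : R) : 0 < l1 -> 0 < l2 -> le_cp idfun (l1%:C *: Phi1) ->
    le_cp idfun (l2%:C *: Phi2) -> (Ind_cp Phi12 <= (Num.sqrt (l1 * l2))%:E)%E.
  move=> l10 l20 /(le_cp_inv _ l10) h1 /(le_cp_inv _ l20) h2.
  apply: Ind_cp_le; first by rewrite sqrtr_gt0 mulr_gt0.
  apply/le_cp_inv; first by rewrite sqrtr_gt0 mulr_gt0.
  have := lower _ _ _ _ h1 h2; rewrite -invfM sqrtrV ?mulr_ge0 ?ltW//.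
  by apply; rewrite invr_gt0.
have [k1 k10 hk1] := Ind_cp_nonempty fin1.
have [k2 k20 hk2] := Ind_cp_nonempty fin2.
have [d dE d0] := Ind_cp_fin (le_lt_trans (bound _ _ k10 k20 hk1 hk2) (ltry _)).
have [a1 a1E a10] := Ind_cp_fin fin1; have [a2 a2E a20] := Ind_cp_fin fin2.
have d2 (l1 l2 : R) : 0 < l1 -> 0 < l2 -> le_cp idfun (l1%:C *: Phi1) ->
    le_cp idfun (l2%:C *: Phi2) -> d ^+ 2 <= l1 * l2.
  move=> l10 l20 h1 h2; have := bound _ _ l10 l20 h1 h2;
    rewrite dE lee_fin => h.
  rewrite -(sqr_sqrtr (mulr_ge0 (ltW l10) (ltW l20))).
  by rewrite ler_pXn2r ?nnegrE ?sqrtr_ge0.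
(* The infimum is taken in one factor at a time, in the squared inequality, where dividing by the
   other factor isolates it. *)
have d3 l2 : 0 < l2 -> le_cp idfun (l2%:C *: Phi2) -> d ^+ 2 <= a1 * l2.
  move=> l20 h2; rewrite -ler_pdivrMr// -lee_fin -a1E.
  by apply: Ind_cp_ge => l1 l10 h1; rewrite ler_pdivrMr//; exact: d2.
have d4 : d ^+ 2 <= a1 * a2.
  (* Division by [a1] fails when it is 0, but then [d3] already gives [d ^+ 2 <= 0]. *)
  move: a10; rewrite le_eqVlt => /predU1P[a1z|a1p].
    by have := d3 _ k20 hk2; rewrite -a1z !mul0r.
  rewrite mulrC -ler_pdivrMr// -lee_fin -a2E.
  by apply: Ind_cp_ge => l2 l20 h2; rewrite ler_pdivrMr// mulrC; exact: d3.
rewrite dE a1E a2E -EFinM /= lee_fin.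
by rewrite -(ger0_norm d0) -sqrtr_sqr ler_sqrt// mulr_ge0.
Qed.
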